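(* Let $k$ be an algebraically closed field of characteristic $p>0$. 1. Let $n\ge 6$ and let $X\subset \mathbb{A}^n_k$ be a general hypersurface singular at $0$. Then the first Frobenius neighbourhood of $0\in X$ does not have a divided power structure and it does not lift to $W_2(k)$. 2. Let $q=p^r$ with $r\ge 1$, let $n\ge 3q$, and let $X\subset \mathbb{A}^n_k$ be a general hypersurface with multiplicity $\ge q$ at $0$. Then the $r$-th Frobenius neighbourhood of $0\in X$ is not liftable to any local ring $R$ with residue field $k$ such that $pR\ne 0$ and $m_R^{q}=0$, where $m_R$ is the maximal ideal of $R$.
   Context: Let $m_0=(x_1,\dots,x_n)\subset k[x_1,\dots,x_n]$. For a hypersurface $X=(f=0)\subset\mathbb{A}^n_k$ through $0$ and $r\ge1$, the $r$-th Frobenius neighbourhood of $0\in X$ is the scheme $\operatorname{Spec} A$ with $A=k[x_1,\dots,x_n]/(x_1^{p^r},\dots,x_n^{p^r},f)$. The hypersurface $(f=0)$ is singular at $0$ if $f\in m_0^2$, and has multiplicity $\ge q$ at $0$ if $f\in m_0^q$. ''General'' means: corresponding to a general point of the parameter space. In part 1: there is a nonempty Zariski open subset $U$ of the finite-dimensional $k$-vector space $m_0^2/(x_1^p,\dots,x_n^p)$ such that the assertion holds for every $f\in m_0^2$ whose class lies in $U$. In part 2: there is a nonempty Zariski open subset $U$ (independent of $R$) of the finite-dimensional $k$-vector space $m_0^q/(x_1^q,\dots,x_n^q)$ such that the assertion holds for every $f\in m_0^q$ whose class lies in $U$. The first Frobenius neighbourhood ''has a divided power structure'' if the ideal $m_0A\subset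 A$ (with $r=1$) admits one. A divided power structure on an ideal $I$ of a commutative ring $A$ is a sequence of maps $\gamma_n: I\to A$, $n\ge 0$, such that for all $x,y\in I$, $a\in A$: $\gamma_0(x)=1$, $\gamma_1(x)=x$, $\gamma_n(x)\in I$ for $n\ge1$; $\gamma_n(x+y)=\sum_{i+j=n}\gamma_i(x)\gamma_j(y)$; $\gamma_n(ax)=a^n\gamma_n(x)$; $\gamma_n(x)\gamma_m(x)=\binom{n+m}{n}\gamma_{n+m}(x)$; $\gamma_n(\gamma_m(x))=\frac{(nm)!}{n!(m!)^n}\gamma_{nm}(x)$ for $m\ge 1$. $W_2(k)$ is the ring of Witt vectors of length $2$, with its canonical surjection $W_2(k)\to k$. For a surjective ring homomorphism $R\to k$ (for a local ring $R$ with residue field $k$, the canonical projection), a $k$-scheme $X$ is liftable to $R$ if there exist a flat $R$-scheme $\tilde X$ and a closed embedding $X\hookrightarrow\tilde X$ inducing an isomorphism $X\to\tilde X\times_{\operatorname{Spec} R}\operatorname{Spec} k$. *)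

(* Defs.v *)
From HB Require Import structures.
From mathcomp Require Import all_boot all_order all_algebra.
From mathcomp Require Import boolp.
From mathcomp Require Import mpoly ring.

Set Implicit Arguments.
Unset Strict Implicit.
Unset Printing Implicit Defensive.
Import GRing.Theory.
Local Open Scope ring_scope.

(** * Ideals *)

Section Ideals.
Variable A : comPzRingType.
Implicit Types (S I J : A -> Prop) (a x y : A).

Definition is_ideal I : Prop :=
  [/\ I 0, forall x y, I x -> I y -> I (x + y) & forall a x, I x -> I (a * x)].

Definition gen_ideal S x : Prop :=
  exists (m : nat) (a s : 'I_m -> A),
    (forall i, S (s i)) /\ x = \sum_i a i * s i.

Definition ideal_mul I J : A -> Prop :=
  gen_ideal (fun z => exists x y, [/\ I x, J y & z = x * y]).

Fixpoint ideal_pow I (n : nat) : A -> Prop :=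
  if n is m.+1 then ideal_mul I (ideal_pow I m) else fun=> True.

Definition maximal_ideal I : Prop :=
  [/\ is_ideal I, ~ I 1 &
      forall J, is_ideal J -> ~ J 1 -> (forall x, I x -> J x) ->
        forall x, J x -> I x].

Definition local_ring_at I : Prop :=
  maximal_ideal I /\
  forall J, maximal_ideal J -> forall x, J x <-> I x.

Lemma gen_ideal_sub S x : S x -> gen_ideal S x.
Proof.
by move=> Sx; exists 1%N, (fun=> 1), (fun=> x); rewrite big_ord1 mul1r.
Qed.

Lemma gen_idealP S : is_ideal (gen_ideal S).
Proof.
split.
- by exists 0%N, (fun=> 0), (fun=> 0); split=> [[]|]; rewrite ?big_ord0.
- move=> x y [m [a [s [Ss ->]]]] [m' [a' [s' [Ss' ->]]]].
  pose glue (f : 'I_m -> A) (f' : 'I_m' -> A) (i : 'I_(m + m')) :=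
    match split i with inl j => f j | inr j => f' j end.
  exists (m + m')%N, (glue a a'), (glue s s'); split.
    by move=> i; rewrite /glue; case: (split i).
  rewrite big_split_ord /=; congr (_ + _); apply: eq_bigr => i _.
    by rewrite /glue -[lshift _ _]/(unsplit (inl i)) unsplitK.
  by rewrite /glue -[rshift _ _]/(unsplit (inr i)) unsplitK.
- move=> b x [m [a [s [Ss ->]]]]; exists m, (fun i => b * a i), s; split=> //.
  by rewrite mulr_sumr; apply: eq_bigr => i _; rewrite mulrA.
Qed.

Lemma gen_ideal_min S I : is_ideal I -> (forall x, S x -> I x) ->
  forall x, gen_ideal S x -> I x.
Proof.
move=> [I0 ID IM] SI _ [m [a [s [Ss ->]]]].
by elim/big_ind: _ => // i _; apply/IM/SI.
Qed.

End Ideals.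

(** * Quotient rings

   [{ideal_quot I}] is a ring only for a proper boolean ideal; here the ideal is
   given by arbitrary generators and the quotient may be zero. *)

Section QuotientRing.
Variables (A : comPzRingType) (S : A -> Prop).

Definition gen_idealb : {pred A} := fun x => `[< gen_ideal S x >].

Lemma gen_idealb_zmod : zmod_closed gen_idealb.
Proof.
have [I0 ID IM] := gen_idealP S; split; first exact/asboolP.
move=> x y /asboolP Ix /asboolP Iy; apply/asboolP/ID => //.
by rewrite -mulN1r; apply: IM.
Qed.

HB.instance Definition _ := GRing.isZmodClosed.Build A gen_idealb gen_idealb_zmod.

Lemma gen_idealbM a x : x \in gen_idealb -> a * x \in gen_idealb.
Proof.
by have [_ _ IM] := gen_idealP S; move=> /asboolP Ix; apply/asboolP/IM.
Qed.

Definition quo_ring := Quotient.quot gen_idealb.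
HB.instance Definition _ := GRing.Zmodule.on quo_ring.

Definition quo_pi (x : A) : quo_ring := (\pi_(Quotient.quot gen_idealb) x)%qT.

Lemma quo_piP x y : quo_pi x = quo_pi y <-> gen_ideal S (x - y).
Proof.
split=> [/eqP | Sxy]; last apply/eqP.
  by rewrite -Quotient.idealrBE => /asboolP.
by rewrite -Quotient.idealrBE; apply/asboolP.
Qed.

Lemma quo_pi_surj (z : quo_ring) : exists x, quo_pi x = z.
Proof. by exists (repr z); apply: reprK. Qed.

Lemma quo_pi_zmod : zmod_morphism quo_pi.
Proof. exact: (pi_is_zmod_morphism (Quotient.quot gen_idealb)). Qed.

HB.instance Definition _ := GRing.isZmodMorphism.Build A quo_ring quo_pi quo_pi_zmod.

Definition quo_one : quo_ring := quo_pi 1.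
Definition quo_mul (u v : quo_ring) : quo_ring := quo_pi (repr u * repr v).

Lemma quo_piM x y : quo_mul (quo_pi x) (quo_pi y) = quo_pi (x * y).
Proof.
have reprP z : repr (quo_pi z) - z \in gen_idealb.
  by rewrite Quotient.idealrBE reprK.
apply/eqP; rewrite -Quotient.idealrBE.
set x' := repr _; set y' := repr _.
have ->: x' * y' - x * y = y' * (x' - x) + x * (y' - y).
  by rewrite !mulrBr addrA (mulrC y' x) subrK (mulrC y').
by rewrite rpredD // gen_idealbM // reprP.
Qed.

Lemma quo_mulA : associative quo_mul.
Proof.
move=> u v w; case: (quo_pi_surj u) (quo_pi_surj v) (quo_pi_surj w).
by move=> x <- [y <-] [z <-]; rewrite !quo_piM mulrA.
Qed.

Lemma quo_mulC : commutative quo_mul.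
Proof.
move=> u v; case: (quo_pi_surj u) (quo_pi_surj v).
by move=> x <- [y <-]; rewrite !quo_piM mulrC.
Qed.

Lemma quo_mul1 : left_id quo_one quo_mul.
Proof. by move=> u; case: (quo_pi_surj u) => x <-; rewrite quo_piM mul1r. Qed.

Lemma quo_mulDl : left_distributive quo_mul +%R.
Proof.
move=> u v w; case: (quo_pi_surj u) (quo_pi_surj v) (quo_pi_surj w).
move=> x <- [y <-] [z <-]; rewrite !quo_piM -[_ + quo_pi y]raddfD quo_piM.
by rewrite -raddfD mulrDl.
Qed.

HB.instance Definition _ := GRing.Zmodule_isComPzRing.Build quo_ring
  quo_mulA quo_mulC quo_mul1 quo_mulDl.

Lemma quo_pi_monoid : monoid_morphism quo_pi.
Proof. by split=> [//|x y]; rewrite -quo_piM. Qed.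

HB.instance Definition _ :=
  GRing.isMonoidMorphism.Build A quo_ring quo_pi quo_pi_monoid.

End QuotientRing.

(** * Schemes

   Schemes are taken in their functor-of-points form (Demazure-Gabriel,
   Groupes algebriques, I, 1): a functor from commutative rings to sets that is
   a sheaf for the Zariski topology and has a covering by open affine
   subfunctors. *)

Lemma rmorph_ext (A B : pzSemiRingType) (f g : {rmorphism A -> B}) :
  f =1 g -> f = g.
Proof.
case: f g => [f [[f1] [f2]]] [g [[g1] [g2]]] /= /funext fg; subst g.
by congr (GRing.RMorphism.Pack (GRing.RMorphism.Class _ _));
   congr (_ _); apply: Prop_irrelevance.
Qed.

Record zfunctor := ZFunctor {
  zpts :> comPzRingType -> Type;
  zmap : forall A B : comPzRingType, {rmorphism A -> B} -> zpts A -> zpts B;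
  zmap_id : forall (A : comPzRingType) (x : zpts A), zmap idfun x = x;
  zmap_comp : forall (A B C : comPzRingType) (f : {rmorphism A -> B})
    (g : {rmorphism B -> C}) (x : zpts A), zmap (g \o f) x = zmap g (zmap f x)
}.
Arguments zmap X [A B] : rename.

Record ztrans (X Y : zfunctor) := ZTrans {
  zapp :> forall A : comPzRingType, X A -> Y A;
  zapp_nat : forall (A B : comPzRingType) (f : {rmorphism A -> B}) (x : X A),
    zapp (zmap X f x) = zmap Y f (zapp x)
}.
Arguments zapp [X Y] _ [A].

Section Spec.
Variable A : comPzRingType.

Definition spec_map_pts (B C : comPzRingType) (g : {rmorphism B -> C})
    (x : {rmorphism A -> B}) : {rmorphism A -> C} := g \o x.

Lemma spec_map_id (B : comPzRingType) (x : {rmorphism A -> B}) :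
  spec_map_pts idfun x = x.
Proof. exact: rmorph_ext. Qed.

Lemma spec_map_comp (B C D : comPzRingType) (f : {rmorphism B -> C})
    (g : {rmorphism C -> D}) (x : {rmorphism A -> B}) :
  spec_map_pts (g \o f) x = spec_map_pts g (spec_map_pts f x).
Proof. exact: rmorph_ext. Qed.

Definition spec : zfunctor := ZFunctor spec_map_id spec_map_comp.
End Spec.

Section SpecMap.
Variables (A B : comPzRingType) (f : {rmorphism A -> B}).

Definition spec_hom_app (C : comPzRingType) (x : spec B C) : spec A C := x \o f.

Lemma spec_hom_nat (C D : comPzRingType) (g : {rmorphism C -> D}) (x : spec B C) :
  spec_hom_app (zmap (spec B) g x) = zmap (spec A) g (spec_hom_app x).
Proof. exact: rmorph_ext. Qed.

Definition spec_hom : ztrans (spec B) (spec A) := ZTrans spec_hom_nat.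
End SpecMap.

Section FibreProduct.
Variables (X Y S : zfunctor) (f : ztrans X S) (g : ztrans Y S).

Definition fprod_pts (A : comPzRingType) : Type :=
  {z : X A * Y A | f A z.1 = g A z.2}.

Lemma fprod_pts_eq (A : comPzRingType) (z w : fprod_pts A) :
  sval z = sval w -> z = w.
Proof.
case: z w => [z z_fg] [w w_fg] /= zw; subst w.
by congr exist; apply: Prop_irrelevance.
Qed.

Lemma fprod_map_proof (A B : comPzRingType) (h : {rmorphism A -> B})
    (z : fprod_pts A) :
  f B (zmap X h (sval z).1) = g B (zmap Y h (sval z).2).
Proof. by rewrite !zapp_nat (svalP z). Qed.

Definition fprod_map (A B : comPzRingType) (h : {rmorphism A -> B})
    (z : fprod_pts A) : fprod_pts B :=
  exist _ (zmap X h (sval z).1, zmap Y h (sval z).2) (fprod_map_proof h z).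

Lemma fprod_map_id (A : comPzRingType) (z : fprod_pts A) : fprod_map idfun z = z.
Proof. by apply: fprod_pts_eq; rewrite /= !zmap_id; case: (sval z). Qed.

Lemma fprod_map_comp (A B C : comPzRingType) (h : {rmorphism A -> B})
    (h' : {rmorphism B -> C}) (z : fprod_pts A) :
  fprod_map (h' \o h) z = fprod_map h' (fprod_map h z).
Proof. by apply: fprod_pts_eq; rewrite /= !zmap_comp. Qed.

Definition fprod : zfunctor := ZFunctor fprod_map_id fprod_map_comp.

Section Pair.
Variables (T : zfunctor) (u : ztrans T X) (v : ztrans T Y).
Hypothesis uv : forall (A : comPzRingType) (t : T A), f A (u A t) = g A (v A t).

Definition fpair_app (A : comPzRingType) (t : T A) : fprod A :=
  exist _ (u A t, v A t) (uv t).

Lemma fpair_nat (A B : comPzRingType) (h : {rmorphism A -> B}) (t : T A) :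
  fpair_app (zmap T h t) = zmap fprod h (fpair_app t).
Proof. by apply: fprod_pts_eq; rewrite /= !zapp_nat. Qed.

Definition fpair : ztrans T fprod := ZTrans fpair_nat.
End Pair.
End FibreProduct.

Definition is_ziso (X Y : zfunctor) (j : ztrans X Y) : Prop :=
  forall A : comPzRingType, bijective (j A).

(* For [x : X A], i.e. [Spec A -> X], the pullback of an open subfunctor is the
   complement of [V(I)], through which [Spec B -> Spec A] factors iff
   [I B = B]; the pullback of a closed one is [V(I)]. *)
Definition open_immersion (U X : zfunctor) (j : ztrans U X) : Prop :=
  (forall A : comPzRingType, injective (j A)) /\
  forall (A : comPzRingType) (x : X A), exists2 I : A -> Prop, is_ideal I &
    forall (B : comPzRingType) (f : {rmorphism A -> B}),
      (exists u : U B, j B u = zmap X f x) <->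
      gen_ideal (fun b => exists2 a, I a & b = f a) 1.

Definition closed_immersion (Z X : zfunctor) (j : ztrans Z X) : Prop :=
  (forall A : comPzRingType, injective (j A)) /\
  forall (A : comPzRingType) (x : X A), exists2 I : A -> Prop, is_ideal I &
    forall (B : comPzRingType) (f : {rmorphism A -> B}),
      (exists z : Z B, j B z = zmap X f x) <-> (forall a, I a -> f a = 0).

Definition invertible (A : comPzRingType) (a : A) : Prop := exists b, a * b = 1.

Definition is_localization (A L : comPzRingType) (a : A)
    (l : {rmorphism A -> L}) : Prop :=
  invertible (l a) /\
  forall (B : comPzRingType) (f : {rmorphism A -> B}), invertible (f a) ->
    exists! g : {rmorphism L -> B}, forall x, g (l x) = f x.

(* Compatibility of sections on [D(a i)] and [D(a j)] is required over every
   common refinement, rather than over a chosen model of [A_(a i * a j)]. *)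
Definition zariski_sheaf (X : zfunctor) : Prop :=
  forall (A : comPzRingType) (m : nat) (a : 'I_m -> A)
    (L : 'I_m -> comPzRingType) (l : forall i, {rmorphism A -> L i}),
    gen_ideal (fun x => exists i, x = a i) 1 ->
    (forall i, is_localization (a i) (l i)) ->
  forall s : forall i, X (L i),
    (forall i j (C : comPzRingType)
       (u : {rmorphism L i -> C}) (v : {rmorphism L j -> C}),
       (forall x, u (l i x) = v (l j x)) -> zmap X u (s i) = zmap X v (s j)) ->
  exists! x : X A, forall i, zmap X (l i) x = s i.

Definition is_scheme (X : zfunctor) : Prop :=
  zariski_sheaf X /\
  forall (K : fieldType) (x : X K), exists (B : comPzRingType)
    (j : ztrans (spec B) X) (u : spec B K), open_immersion j /\ j K u = x.

(** * Flatness *)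

Section Flat.
Variables (R B : comPzRingType) (f : {rmorphism R -> B}).

(* [R]-bilinear maps out of [M x B], where [B] is an [R]-module through [f] *)
Definition bilinear_map (M T : lmodType R) (t : M -> B -> T) : Prop :=
  [/\ forall m m' b, t (m + m') b = t m b + t m' b,
      forall m b b', t m (b + b') = t m b + t m b',
      forall r m b, t (r *: m) b = r *: t m b &
      forall r m b, t m (f r * b) = r *: t m b].

Definition is_tensor (M T : lmodType R) (t : M -> B -> T) : Prop :=
  bilinear_map t /\
  forall (P : lmodType R) (h : M -> B -> P), bilinear_map h ->
    (exists g : {linear T -> P}, forall m b, g (t m b) = h m b) /\
    (forall g g' : {linear T -> P}, (forall m b, g (t m b) = h m b) ->
       (forall m b, g' (t m b) = h m b) -> g =1 g').

(* [- (x)_R B] preserves injections; [T] and [T'] are any tensor products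
   [M (x)_R B] and [M' (x)_R B], and [v] is [u (x) B]. *)
Definition flat_morphism : Prop :=
  forall (M M' T T' : lmodType R) (t : M -> B -> T) (t' : M' -> B -> T')
    (u : {linear M -> M'}) (v : {linear T -> T'}),
    is_tensor t -> is_tensor t' -> injective u ->
    (forall m b, v (t m b) = t' (u m) b) -> injective v.
End Flat.

(* The ring morphism [R -> B] given by [Spec B -> X -> Spec R] is the image of
   the identity of [B]. *)
Definition flat_over (R : comPzRingType) (X : zfunctor)
    (s : ztrans X (spec R)) : Prop :=
  forall (B : comPzRingType) (j : ztrans (spec B) X), open_immersion j ->
    flat_morphism (s B (j B (idfun : {rmorphism B -> B})) : {rmorphism R -> B}).

(** * Liftability *)

Definition liftable (R k : comPzRingType) (rho : {rmorphism R -> k})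
    (X : zfunctor) (t : ztrans X (spec k)) : Prop :=
  exists (X' : zfunctor) (s : ztrans X' (spec R)) (i : ztrans X X')
    (it : forall (A : comPzRingType) (x : X A),
            s A (i A x) = spec_hom rho A (t A x)),
    [/\ is_scheme X', flat_over s, closed_immersion i & is_ziso (fpair it)].

(** * Divided powers *)

Record pd_structure (A : comPzRingType) (I : A -> Prop) (g : nat -> A -> A) : Prop := {
  pd0 : forall x, I x -> g 0 x = 1;
  pd1 : forall x, I x -> g 1 x = x;
  pd_ideal : forall n x, (1 <= n)%N -> I x -> I (g n x);
  pdD : forall n x y, I x -> I y ->
    g n (x + y) = \sum_(i < n.+1) g i x * g (n - i)%N y;
  pdZ : forall n a x, I x -> g n (a * x) = a ^+ n * g n x;
  pdM : forall n m x, I x -> g n x * g m x = 'C(n + m, n)%:R * g (n + m)%N x;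
  pd_comp : forall n m x, (1 <= m)%N -> I x ->
    g n (g m x) = ((n * m)`! %/ (n`! * m`! ^ n))%:R * g (n * m)%N x
}.

(** * Witt vectors of length 2

   With ghost components [a_0] and [a_0 ^ p + p a_1], the sum has second
   component [a_1 + b_1 - witt_carry a_0 b_0], where
   [p * witt_carry x y = (x + y) ^ p - x ^ p - y ^ p]. *)

Definition witt_carry (p : nat) (k : comNzRingType) (x y : k) : k :=
  \sum_(1 <= i < p) (x ^+ (p - i) * y ^+ i) *+ ('C(p, i) %/ p).

Section WittCarry.
Variables (p : nat) (pr_p : prime p).
Local Notation carry := (witt_carry p).

Lemma witt_carryE (k : comNzRingType) (x y : k) :
  carry x y *+ p = (x + y) ^+ p - x ^+ p - y ^+ p.
Proof.
have p_gt0 := prime_gt0 pr_p.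
rewrite exprDn -(big_mkord xpredT (fun i => (x ^+ (p - i) * y ^+ i) *+ 'C(p, i))).
rewrite big_nat_recr //= big_ltn // subn0 subnn !expr0 mulr1 bin0 mul1r binn !mulr1n.
have ->: forall a b c : k, a + b + c - a - c = b by move=> a b c; ring.
rewrite /witt_carry -sumrMnl !big_nat; apply: eq_bigr => i /andP[i_gt0 lt_ip].
by rewrite -mulrnA divnK // prime_dvd_bin // i_gt0.
Qed.

Lemma rmorph_witt_carry (k k' : comNzRingType) (f : {rmorphism k -> k'}) x y :
  f (carry x y) = carry (f x) (f y).
Proof.
rewrite rmorph_sum; apply: eq_bigr => i _.
by rewrite rmorphMn rmorphM !rmorphXn.
Qed.

Lemma witt_carryC (k : comNzRingType) : commutative (@witt_carry p k).
Proof.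
move=> x y; rewrite /witt_carry big_nat_rev /= big_nat [RHS]big_nat.
apply: eq_bigr => i /andP[i_gt0 lt_ip]; rewrite add1n subSS subKn 1?ltnW //.
by rewrite bin_sub 1?ltnW // mulrC.
Qed.

Lemma witt_carryM (k : comNzRingType) (c x y : k) :
  carry (c * x) (c * y) = c ^+ p * carry x y.
Proof.
rewrite /witt_carry mulr_sumr !big_nat; apply: eq_bigr => i /andP[_ lt_ip].
rewrite mulrnAr !exprMn; congr (_ *+ _).
by rewrite mulrACA -exprD subnK // ltnW.
Qed.

Lemma witt_carry0 (k : comNzRingType) (x : k) : carry x 0 = 0.
Proof.
rewrite /witt_carry big_nat big1 // => i /andP[i_gt0 _].
by rewrite expr0n eqn0Ngt i_gt0 mulr0 mul0rn.
Qed.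

Lemma rmorph_witt_carryA (k k' : comNzRingType) (f : {rmorphism k -> k'}) u v w :
  carry u v + carry (u + v) w = carry v w + carry u (v + w) ->
  carry (f u) (f v) + carry (f u + f v) (f w) =
    carry (f v) (f w) + carry (f u) (f v + f w).
Proof. by move/(congr1 f); rewrite !rmorphD !rmorph_witt_carry !rmorphD. Qed.

Lemma torsionfree_witt_carryA (k : comNzRingType) :
  (forall x y : k, x *+ p = y *+ p -> x = y) ->
  forall x y z : k, carry x y + carry (x + y) z = carry y z + carry x (y + z).
Proof.
move=> pI x y z; apply: pI; rewrite !mulrnDl !witt_carryE (addrA x).
move: (x + y + z) (x + y) (y + z) => a b c.
by move: (a ^+ p) (b ^+ p) (c ^+ p) (x ^+ p) (y ^+ p) (z ^+ p) => *; ring.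
Qed.

(* The identity is checked in a ring of polynomials over the integers, where
   [p] is not a zero divisor. *)
Lemma witt_carryA (k : comNzRingType) (x y z : k) :
  carry x y + carry (x + y) z = carry y z + carry x (y + z).
Proof.
pose P := {mpoly int[3]}.
pose h : 'I_3 -> k := fun i => [:: x; y; z]`_i.
pose f : {rmorphism P -> k} := mmap (intr : int -> k) h.
pose X i : P := 'X_(inord i).
have fX i : (i < 3)%N -> f (X i) = [:: x; y; z]`_i.
  by move=> lt_i3; rewrite /f /X /= mmapX mmap1U /h inordK.
have E0 := fX 0%N isT; have E1 := fX 1%N isT; have E2 := fX 2%N isT.
rewrite -[x]E0 -[y]E1 -[z]E2; apply: rmorph_witt_carryA.
have pI (u v : P) : u *+ p = v *+ p -> u = v.
  move=> /mpolyP uv; apply/mpolyP => m; move: (uv m); rewrite !mcoeffMn.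
  move=> /eqP; rewrite -subr_eq0 -mulrnBl Num.Theory.mulrn_eq0.
  by rewrite eqn0Ngt prime_gt0 // subr_eq0 => /eqP.
exact: (torsionfree_witt_carryA pI).
Qed.

End WittCarry.

Record witt2 (p : nat) (pr_p : prime p) (k : comNzRingType) :=
  Witt2 { witt0 : k; witt1 : k }.

Section Witt2.
Variables (p : nat) (pr_p : prime p) (k : comNzRingType).
Local Notation W := (witt2 pr_p k).
Local Notation Mk := (@Witt2 p pr_p k).
Local Notation carry := (@witt_carry p k).

Definition witt2_pair (a : W) : k * k := (witt0 a, witt1 a).
Definition witt2_of_pair (a : k * k) : W := Mk a.1 a.2.
Lemma witt2_pairK : cancel witt2_pair witt2_of_pair. Proof. by case. Qed.
HB.instance Definition _ := Choice.copy W (can_type witt2_pairK).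

Definition witt2_add (a b : W) : W :=
  Mk (witt0 a + witt0 b) (witt1 a + witt1 b - carry (witt0 a) (witt0 b)).
Definition witt2_opp (a : W) : W :=
  Mk (- witt0 a) (- witt1 a + carry (witt0 a) (- witt0 a)).
Definition witt2_mul (a b : W) : W :=
  Mk (witt0 a * witt0 b)
     (witt0 a ^+ p * witt1 b + witt1 a * witt0 b ^+ p + (witt1 a * witt1 b) *+ p).

Lemma witt2_addA : associative witt2_add.
Proof.
move=> [a0 a1] [b0 b1] [c0 c1]; rewrite /witt2_add /= addrA; congr Mk.
have ->: carry a0 (b0 + c0) =
    carry a0 b0 + carry (a0 + b0) c0 - carry b0 c0.
  by rewrite (witt_carryA pr_p) [RHS]addrC addKr.
ring.
Qed.

Lemma witt2_addC : commutative witt2_add.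
Proof.
move=> [a0 a1] [b0 b1]; rewrite /witt2_add /= (addrC a0) (addrC a1).
by rewrite witt_carryC.
Qed.

Lemma witt2_add0 : left_id (Mk 0 0) witt2_add.
Proof. by move=> [a0 a1]; rewrite /witt2_add /= witt_carryC witt_carry0 subr0 !add0r. Qed.

Lemma witt2_addN : left_inverse (Mk 0 0) witt2_opp witt2_add.
Proof.
move=> [a0 a1]; rewrite witt2_addC /witt2_add /= subrr addrA subrr add0r.
by rewrite subrr.
Qed.

HB.instance Definition _ := GRing.isZmodule.Build W
  witt2_addA witt2_addC witt2_add0 witt2_addN.

Lemma witt2_mulA : associative witt2_mul.
Proof.
move=> [a0 a1] [b0 b1] [c0 c1]; rewrite /witt2_mul /= mulrA; congr Mk.
by rewrite !exprMn; ring.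
Qed.

Lemma witt2_mulC : commutative witt2_mul.
Proof.
move=> [a0 a1] [b0 b1]; rewrite /witt2_mul /= mulrC; congr Mk; ring.
Qed.

Lemma witt2_mul1 : left_id (Mk 1 0) witt2_mul.
Proof. by move=> [a0 a1]; rewrite /witt2_mul /= expr1n !(mul1r, mul0r) mul0rn !addr0. Qed.

Lemma witt2_mulD : left_distributive witt2_mul +%R.
Proof.
move=> [a0 a1] [b0 b1] [c0 c1].
rewrite -[_ + Mk b0 b1]/(witt2_add _ _) -[RHS]/(witt2_add _ _).
rewrite /witt2_mul /witt2_add /= mulrDl; congr Mk.
rewrite (mulrC a0) (mulrC b0) witt_carryM.
have ->: (a0 + b0) ^+ p = carry a0 b0 *+ p + a0 ^+ p + b0 ^+ p.
  by rewrite (witt_carryE pr_p); ring.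
ring.
Qed.

Lemma witt2_1neq0 : Mk 1 0 != 0.
Proof. by apply/eqP=> /(congr1 (@witt0 _ _ _)) /eqP; rewrite /= oner_eq0. Qed.

HB.instance Definition _ := GRing.Zmodule_isComNzRing.Build W
  witt2_mulA witt2_mulC witt2_mul1 witt2_mulD witt2_1neq0.

Definition witt2_res (a : W) : k := witt0 a.

Lemma witt2_res_zmod : zmod_morphism witt2_res.
Proof. by []. Qed.
HB.instance Definition _ := GRing.isZmodMorphism.Build W k witt2_res witt2_res_zmod.

Lemma witt2_res_monoid : monoid_morphism witt2_res.
Proof. by []. Qed.
HB.instance Definition _ := GRing.isMonoidMorphism.Build W k witt2_res witt2_res_monoid.

End Witt2.

(** * Frobenius neighbourhoods of hypersurface germs *)

Section FrobeniusNeighbourhood.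
Variables (k : fieldType) (n : nat).
Implicit Type f : {mpoly k[n]}.

Definition m0 : {mpoly k[n]} -> Prop := gen_ideal (fun g => exists i, g = 'X_i).

Section Neighbourhood.
Variables (p r : nat) (f : {mpoly k[n]}).

Definition frob_ring : comPzRingType :=
  quo_ring (fun g => (exists i, g = 'X_i ^+ (p ^ r)) \/ g = f).

Definition frob_pi : {rmorphism {mpoly k[n]} -> frob_ring} :=
  @quo_pi {mpoly k[n]} _.

Definition frob_nbhd : zfunctor := spec frob_ring.

Definition frob_str : ztrans frob_nbhd (spec k) :=
  spec_hom (frob_pi \o @mpolyC n k : {rmorphism k -> frob_ring}).

Definition m0_frob : frob_ring -> Prop :=
  gen_ideal (fun a => exists2 g, m0 g & a = frob_pi g).
End Neighbourhood.

(* For [d <= e] the monomials of degree at least [d] with all exponents [< e]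
   form a basis of [m0 ^ d / (X_1 ^ e, ..., X_n ^ e)]; [trunc_coord] gives the
   coordinates in this basis of the class of an element of [m0 ^ d]. *)
Definition trunc_mon (e d : nat) : finType :=
  {m : {ffun 'I_n -> 'I_e} | (d <= \sum_i m i)%N}.

Definition trunc_mnm (e d : nat) (m : trunc_mon e d) : 'X_{1..n} :=
  [multinom (val m i : nat) | i < n].

Definition trunc_coord (e d : nat) f : 'rV[k]_#|trunc_mon e d| :=
  \row_j f@_(trunc_mnm (enum_val j)).

End FrobeniusNeighbourhood.

Definition zariski_open (k : fieldType) (N : nat) (U : 'rV[k]_N -> Prop) : Prop :=
  exists S : {mpoly k[N]} -> Prop,
    forall v, U v <-> exists2 P, S P & P.@[v ord0] != 0.

Lemma gen_ideal_sum (A : comPzRingType) (S : A -> Prop) (T : eqType)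
    (s : seq T) (F : T -> A) :
  (forall t, t \in s -> gen_ideal S (F t)) -> gen_ideal S (\sum_(t <- s) F t).
Proof.
have [I0 ID _] := gen_idealP S => SF.
by rewrite big_seq; elim/big_ind: _ => // t /SF.
Qed.

(* [trunc_coord e d] identifies [m0 ^ d / (X_1 ^ e, ..., X_n ^ e)] with the
   space of all row vectors. *)
Section TruncCoord.
Variables (k : fieldType) (n : nat).
Implicit Types (f g : {mpoly k[n]}) (m : 'X_{1..n}).

Lemma ideal_pow_m0_mcoeff d f :
  ideal_pow (@m0 k n) d f -> forall m, (mdeg m < d)%N -> f@_m = 0.
Proof.
have vanP c : is_ideal (fun g : {mpoly k[n]} => forall m, (mdeg m < c)%N -> g@_m = 0).
  split=> [m _|g h g0 h0 m m_c|a g g0 m m_c]; first exact: mcoeff0.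
    by rewrite mcoeffD g0 // h0 // addr0.
  rewrite mcoeffM big1 // => -[[u ?] [v ?]] /= /eqP muv; rewrite g0 ?mulr0 //.
  apply: leq_ltn_trans m_c; rewrite muv mdegD leq_addl //.
elim: d f => // d IHd; apply: (gen_ideal_min (vanP d.+1)) => _ [g [h [m0g /IHd h0 ->]]] m m_d.
have g0 u : mdeg u = 0%N -> g@_u = 0.
  move=> u0; apply: (gen_ideal_min (vanP 1%N) _ m0g); last by rewrite u0.
  move=> _ [i ->] w; rewrite ltnS leqn0 mcoeffX => w0.
  by case: (U_(i)%MM =P w) w0 => // <-; rewrite mdeg1.
rewrite mcoeffM big1 // => -[[u ?] [v ?]] /= /eqP muv.
have [u0|u_gt0] := posnP (mdeg u); first by rewrite g0 ?mul0r.
rewrite h0 ?mulr0 // -ltnS (leq_trans _ m_d) // muv mdegD ltnS.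
by rewrite -[leqLHS]add1n leq_add2r.
Qed.

Lemma mpolyX_ideal_pow d m : (d <= mdeg m)%N -> ideal_pow (@m0 k n) d 'X_[m].
Proof.
elim: d m => [//|d IHd] m d_m.
have [i mi]: exists i, (0 < m i)%N.
  apply/existsP; apply: contraLR d_m => /existsPn m0'.
  rewrite -ltnNge mdegE big1 // => i _.
  by apply/eqP; rewrite -leqn0 leqNgt m0'.
have def_m : m = (U_(i) + (m - U_(i)))%MM.
  rewrite addmC submK //; apply/mnm_lepP => j; rewrite mnm1E.
  by case: eqP => // <-.
apply: gen_ideal_sub; exists 'X_i, 'X_[m - U_(i)]; split.
- by apply: gen_ideal_sub; exists i.
- apply: IHd; move: d_m; rewrite {1}def_m mdegD mdeg1 //.
- by rewrite -mpolyXD -def_m.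
Qed.

Lemma mpolyX_gen_pow e m i :
  (e <= m i)%N -> gen_ideal (fun g : {mpoly k[n]} => exists i, g = 'X_i ^+ e) 'X_[m].
Proof.
move=> e_mi; have [_ _ IM] := gen_idealP (fun g : {mpoly k[n]} => exists i, g = 'X_i ^+ e).
have ->: m = (m - U_(i) *+ e + U_(i) *+ e)%MM.
  rewrite submK //; apply/mnm_lepP => j; rewrite mulmnE mnm1E.
  by case: eqP => [<-|]; rewrite ?mul1n.
by rewrite mpolyXD -mpolyXn; apply/IM/gen_ideal_sub; exists i.
Qed.

Lemma gen_pow_mcoeff e f :
  gen_ideal (fun g : {mpoly k[n]} => exists i, g = 'X_i ^+ e) f ->
  forall m, (forall i, m i < e)%N -> f@_m = 0.
Proof.
move: f; apply: gen_ideal_min => [|_ [i ->] m m_e].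
  split=> [m _|g h g0 h0 m m_e|a g g0 m m_e]; first exact: mcoeff0.
    by rewrite mcoeffD g0 // h0 // addr0.
  rewrite mcoeffM big1 // => -[[u ?] [v ?]] /= /eqP muv; rewrite g0 ?mulr0 // => i.
  by apply: leq_ltn_trans (m_e i); rewrite muv mnmDE leq_addl.
rewrite mcoeffXn; case: eqP (m_e i) => // <-.
by rewrite mulmnE mnm1E eqxx mul1n ltnn.
Qed.

Lemma trunc_coord_eq0 e d f : ideal_pow (@m0 k n) d f ->
  trunc_coord e d f = 0 <->
  gen_ideal (fun g : {mpoly k[n]} => exists i, g = 'X_i ^+ e) f.
Proof.
move=> f_d; split=> [f0|f_e]; last first.
  apply/rowP => j; rewrite !mxE (gen_pow_mcoeff f_e) // => i.
  by rewrite mnmE ltn_ord.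
rewrite [f]mpolyE; apply: gen_ideal_sum => m.
rewrite mcoeff_msupp => fm; have [_ _ IM] := gen_idealP
  (fun g : {mpoly k[n]} => exists i, g = 'X_i ^+ e).
rewrite -mul_mpolyC; apply: IM.
have [/existsP[i]|/existsPn m_e] := boolP [exists i, (e <= m i)%N].
  exact: mpolyX_gen_pow.
have {}m_e i : (m i < e)%N by rewrite ltnNge m_e.
pose m' : {ffun 'I_n -> 'I_e} := [ffun i => Ordinal (m_e i)].
have m'_d : (d <= \sum_i m' i)%N.
  rewrite leqNgt; apply: contra fm => m_d.
  rewrite (ideal_pow_m0_mcoeff f_d) // mdegE; apply: leq_ltn_trans m_d.
  by apply: leq_sum => i _; rewrite ffunE.
have mE : trunc_mnm (Sub m' m'_d : trunc_mon n e d) = m.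
  by apply/mnmP => i; rewrite mnmE /= ffunE.
move/rowP/(_ (enum_rank (Sub m' m'_d : trunc_mon n e d))): f0.
by rewrite !mxE enum_rankK mE => /eqP; rewrite (negPf fm).
Qed.

Lemma trunc_coord_surj e d (v : 'rV[k]_#|trunc_mon n e d|) :
  exists2 f, ideal_pow (@m0 k n) d f & trunc_coord e d f = v.
Proof.
exists (\sum_j v ord0 j *: 'X_[trunc_mnm (enum_val j)]).
  case: d v => [//|d] v; apply: gen_ideal_sum => j _.
  rewrite -mul_mpolyC; have [_ _ IM] := gen_idealP (fun z : {mpoly k[n]} =>
    exists x y, [/\ m0 x, ideal_pow (@m0 k n) d y & z = x * y]).
  apply: IM; apply: (@mpolyX_ideal_pow d.+1); apply: leq_trans (valP (enum_val j)) _.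
  by rewrite mdegE leq_sum // => i _; rewrite mnmE.
apply/rowP => j; rewrite mxE raddf_sum (bigD1 j) //= big1 => [|i i_j].
  by rewrite mcoeffZ mcoeffX eqxx mulr1 addr0.
rewrite mcoeffZ mcoeffX; case: eqP => [ij|_]; last by rewrite mulr0.
case/eqP: i_j; apply/enum_val_inj/val_inj/ffunP => l; apply: val_inj.
by move/mnmP/(_ l): ij; rewrite !mnmE.
Qed.

End TruncCoord.

(* Main.v *)
Require Import Defs.
From HB Require Import structures.
From mathcomp Require Import all_boot all_order all_algebra.
From mathcomp Require Import boolp.
From mathcomp Require Import mpoly.
Import GRing.Theory.
Local Open Scope ring_scope.

Set Implicit Arguments.
Unset Strict Implicit.
Unset Printing Implicit Defensive.

(** Write [q = p ^ r], with [r = 1] in the first part.  For elements [y_1, ..., y_N] of a commutative ring, the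
    difference [(y_1 + ... + y_N) ^ q - (y_1 ^ q + ... + y_N ^ q)] is [p] times a
    universal polynomial with integer coefficients, here called the defect of the
    [y_j].  Apply this to the terms [y_j] of [f] all of whose exponents are below
    [q]: their sum [f'] agrees with [f] modulo the [x_i ^ q], so it is zero in the
    coordinate ring [A] of the Frobenius neighbourhood.  Both structures in the
    theorem force the defect of these terms to be zero in [A].

    - Divided powers ([r = 1]).  When [gamma_p] kills every [y_j], additivity of
      divided powers says that [(p - 1)! gamma_p (y_1 + ... + y_N)] is the defect
      of the [y_j] ([frob_defect_pd]).  Here each [y_j] has degree at least two,
      hence is [x_i] times an element with zero [p]-th power, and [gamma_p] kills
      it, while [gamma_p 0 = 0] ([defect_eq0_of_pd]).

    - Liftings.  A lifting contains an affine one, [Spec B] with [B] flat over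
      [R] and [B / I B = A], where [I] is the kernel of [R -> k]
      ([liftable_affine]).  Lift the coefficients to [R] and the variables to [B].
      The lifted sum and the [x_i ^ q] lie in [I B], and a product of [d] elements
      of [I B] is zero, with [d <= q] the multiplicity in question; so the [q]-th
      powers of the sum and of every lifted term are zero, and [p] times the defect
      is zero in [B].  As [p] is not zero in [R], its annihilator is in [I], and by
      flatness its annihilator in [B] is in [I B] ([flat_annihilator]).  Hence the
      defect is zero in [A] ([defect_eq0_of_liftable]).

    It remains to see that the defect is not zero in [A] for general [f].  If it
    is, it lies in the ideal [(f', x_1 ^ q, ..., x_n ^ q)] of the polynomial ring.
    Multiply by [f' ^ (q - 1)]: since [f' ^ q] lies in [(x_1 ^ q, ..., x_n ^ q)], all
    coefficients of [f' ^ (q - 1) * defect] at exponents below [q] are zero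
    ([defect_coef_eq0]).  Each of them is a polynomial in the coefficients of [f'],
    so it is enough to find one [f'] and one coefficient that is not zero.  Take
    [f' = u + v + w] with [u], [v], [w] products of [d] distinct variables each, over
    the integers.  At exponents below [q], the polynomial [p f' ^ (q - 1) * defect]
    agrees with [f' ^ (2 q - 1)], whose coefficient at
    [u ^ (q - 1) v ^ (q - q / p) w ^ (q / p)] is divisible by [p] but not by
    [p ^ 2] ([defect_coef_block]). *)

(** * Binomial coefficients at prime powers *)

Section BinomialsModP.
Local Open Scope nat_scope.
Variables (p r : nat).
Hypothesis pr_p : prime p.

Lemma dvdn_bin_expn i : 0 < i < p ^ r -> p %| 'C(p ^ r, i).
Proof.
case: i => // i /= lt_iq; apply: contraTT lt_iq => p'C.
rewrite -leqNgt dvdn_leq // -(@Gauss_dvdl _ _ 'C(p ^ r, i.+1)).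
  have := mul_bin_diag (p ^ r) i => <-; exact: dvdn_mulr.
by rewrite coprimeXl // prime_coprime.
Qed.

(** By Pascal's rule neighbours in this row are opposite modulo [p]. *)
Lemma ndvdn_bin_expn_pred j : j < p ^ r -> ~~ (p %| 'C((p ^ r).-1, j)).
Proof.
elim: j => [|j IHj] lt_jq.
  by rewrite bin0 dvdn1 neq_ltn prime_gt1 ?orbT.
have q_gt0 : 0 < p ^ r by rewrite expn_gt0 prime_gt0.
have /dvdn_bin_expn : 0 < j.+1 < p ^ r by [].
rewrite -{1}(prednK q_gt0) binS => pD.
by apply: contra (IHj (ltnW lt_jq)) => pC; rewrite -(dvdn_addr _ pC).
Qed.

(** In the Vandermonde expansion of the coefficient of [q + (q - 1)] over [q - 1]
    only the term that takes nothing from [q] survives modulo [p]. *)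
Lemma ndvdn_bin_double : ~~ (p %| 'C(2 * p ^ r - 1, p ^ r)).
Proof.
have q_gt0 : 0 < p ^ r by rewrite expn_gt0 prime_gt0.
set q := p ^ r in q_gt0 *.
have le_q : q <= 2 * q - 1 by rewrite mul2n -addnn -addnBA // leq_addr.
rewrite -bin_sub //; have -> : 2 * q - 1 - q = q.-1.
  by rewrite subnAC mul2n -addnn addnK subn1.
have -> : 2 * q - 1 = q + q.-1 by rewrite mul2n -addnn -addnBA // subn1.
rewrite -binomial.Vandermonde -(big_mkord xpredT (fun j => 'C(q, j) * 'C(q.-1, q.-1 - j))).
rewrite big_nat_recl // bin0 mul1n subn0 binn.
rewrite dvdn_addl ?dvdn1 ?neq_ltn ?prime_gt1 ?orbT // big_nat.
apply: dvdn_sum => j /= lt_jq; apply/dvdn_mulr/dvdn_bin_expn => //=.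
by rewrite -/q -(prednK q_gt0) ltnS.
Qed.

Lemma bin_expn_expn_pred :
  0 < r -> 'C(p ^ r, p ^ r.-1) = p * 'C((p ^ r).-1, (p ^ r.-1).-1).
Proof.
case: r => // s _ /=; have s_gt0 : 0 < p ^ s by rewrite expn_gt0 prime_gt0.
have := mul_bin_diag (p ^ s.+1) (p ^ s).-1; rewrite prednK // expnS -mulnA mulnCA.
by move/eqP; rewrite eqn_pmul2l // => /eqP <-.
Qed.

End BinomialsModP.

(** * The Frobenius defect of a sum *)

Section FrobeniusDefect.
Variables (p r : nat).
Local Notation q := (p ^ r)%N.

Definition frob_carry (A : comPzRingType) (x y : A) : A :=
  \sum_(1 <= i < q) (x ^+ (q - i) * y ^+ i) *+ ('C(q, i) %/ p).

(** [p] times it is the difference between the [q]-th power of a sum and the sum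
    of the [q]-th powers.  It is given by a formula with natural coefficients,
    rather than as a quotient by [p], to make sense in every commutative ring
    and to commute with ring morphisms. *)
Fixpoint frob_defect (A : comPzRingType) (s : seq A) : A :=
  if s is y :: s' then frob_defect s' + frob_carry (\sum_(z <- s') z) y else 0.

Lemma rmorph_frob_defect (A B : comPzRingType) (f : {rmorphism A -> B}) s :
  f (frob_defect s) = frob_defect (map f s).
Proof.
elim: s => [|y s IHs] /=; first exact: rmorph0.
rewrite rmorphD IHs big_map -rmorph_sum; congr (_ + _).
rewrite [LHS]rmorph_sum; apply: eq_bigr => i _.
by rewrite rmorphMn rmorphM !rmorphXn.
Qed.

Hypothesis pr_p : prime p.

Lemma frob_carryE (A : comPzRingType) (x y : A) :
  (x + y) ^+ q = x ^+ q + y ^+ q + frob_carry x y *+ p.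
Proof.
have q_gt0 : (0 < q)%N by rewrite expn_gt0 prime_gt0.
rewrite exprDn -(big_mkord xpredT (fun i => (x ^+ (q - i) * y ^+ i) *+ 'C(q, i))).
rewrite big_nat_recr //= big_ltn // subn0 subnn !expr0 mulr1 bin0 mul1r binn !mulr1n.
rewrite addrAC; congr (_ + _); rewrite /frob_carry -sumrMnl !big_nat.
apply: eq_bigr => i /andP[i_gt0 lt_iq].
by rewrite -mulrnA divnK // dvdn_bin_expn // i_gt0.
Qed.

Lemma frob_defectE (A : comPzRingType) (s : seq A) :
  (\sum_(y <- s) y) ^+ q = \sum_(y <- s) y ^+ q + frob_defect s *+ p.
Proof.
elim: s => [|y s IHs] /=.
  by rewrite !big_nil mul0rn addr0 expr0n expn_eq0 -leqn0 leqNgt prime_gt0.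
rewrite !big_cons addrC frob_carryE IHs mulrnDl addrA; congr (_ + _).
by rewrite addrAC [y ^+ _ + _]addrC.
Qed.

End FrobeniusDefect.

(** * Ring morphisms out of quotients *)

Lemma surj_section (T T' : Type) (f : T -> T') :
  (forall y, exists x, f x = y) -> {s | cancel s f}.
Proof. by move=> f_surj; exists (fun y => sval (cid (f_surj y))) => y; case: cid. Qed.

Lemma rmorph_factor (A K C : comPzRingType) (a : {rmorphism A -> K})
    (b : {rmorphism A -> C}) :
  (forall c, exists x, a x = c) -> (forall x, a x = 0 -> b x = 0) ->
  exists g : {rmorphism K -> C}, forall x, g (a x) = b x.
Proof.
move=> /surj_section[sec secK] ker_ab.
pose g c := b (sec c).
have gE x : g (a x) = b x.
  by apply/eqP; rewrite -subr_eq0 -rmorphB ker_ab // rmorphB secK subrr.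
have g_zmod : zmod_morphism g.
  by move=> x y; rewrite -[x]secK -[y]secK -rmorphB !gE rmorphB.
have g_mon : monoid_morphism g.
  split=> [|x y]; first by rewrite -(rmorph1 a) gE rmorph1.
  by rewrite -[x]secK -[y]secK -rmorphM !gE rmorphM.
pose gZ := GRing.isZmodMorphism.Build K C g g_zmod.
pose gM := GRing.isMonoidMorphism.Build K C g g_mon.
by exists (HB.pack g gZ gM : {rmorphism K -> C}).
Qed.

Lemma quo_pi_eq0 (A : comPzRingType) (S : A -> Prop) x :
  quo_pi S x = 0 <-> gen_ideal S x.
Proof. by rewrite -{1}[0](rmorph0 (quo_pi S)) quo_piP subr0. Qed.

Lemma rmorph_gen_ideal0 (A B : comPzRingType) (f : {rmorphism A -> B})
    (S : A -> Prop) :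
  (forall x, S x -> f x = 0) -> forall x, gen_ideal S x -> f x = 0.
Proof.
move=> fS; apply: gen_ideal_min => //; split=> [|x y fx fy|a x fx].
- exact: rmorph0.
- by rewrite rmorphD fx fy addr0.
- by rewrite rmorphM fx mulr0.
Qed.

(** * Torsion in flat algebras *)

Definition ext_ideal (R B : comPzRingType) (f : {rmorphism R -> B})
    (I : R -> Prop) : B -> Prop :=
  gen_ideal (fun b => exists2 r, I r & b = f r).

Definition restr_scalars (R C : comPzRingType) (g : {rmorphism R -> C}) : Type := C.

Section RestrictionOfScalars.
Variables (R C : comPzRingType) (g : {rmorphism R -> C}).
Local Notation M := (restr_scalars g).

HB.instance Definition _ := GRing.Zmodule.copy M C.

Definition restr_scale (r : R) (x : M) : M := g r * (x : C).

Lemma restr_scaleA r s x : restr_scale r (restr_scale s x) = restr_scale (r * s) x.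
Proof. by rewrite /restr_scale rmorphM mulrA. Qed.
Lemma restr_scale1 : left_id 1 restr_scale.
Proof. by move=> x; rewrite /restr_scale rmorph1 mul1r. Qed.
Lemma restr_scaleDr : right_distributive restr_scale +%R.
Proof. by move=> r x y; apply: mulrDr. Qed.
Lemma restr_scaleDl x : {morph restr_scale^~ x : r s / r + s}.
Proof. by move=> r s; rewrite /restr_scale rmorphD mulrDl. Qed.

HB.instance Definition _ := GRing.Zmodule_isLmodule.Build R M
  restr_scaleA restr_scale1 restr_scaleDr restr_scaleDl.

Lemma restr_scaleE (r : R) (x : M) : r *: x = g r * (x : C) :> C.
Proof. by []. Qed.

End RestrictionOfScalars.

(** Here [M = R / I] and [T = B / I B] for [I] the kernel of [a].  A bilinear map
    [h] is determined by [h 1], because [h (a r) x = h 1 (f r * x)], and [h 1]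
    factors through [T] because it kills the multiples of [f r] when [a r = 0]. *)
Lemma quotient_tensor (R B M T : comPzRingType) (f : {rmorphism R -> B})
    (a : {rmorphism R -> M}) (b : {rmorphism B -> T}) (sec : M -> R) :
  cancel sec a -> (forall t, exists x, b x = t) ->
  (forall x, b x = 0 <-> ext_ideal f (fun r => a r = 0) x) ->
  is_tensor f (fun (m : restr_scalars a) (x : B) =>
    b (f (sec m) * x) : restr_scalars (b \o f)).
Proof.
move=> secK b_surj ker_b.
have bf r s : a r = a s -> b (f r) = b (f s).
  move=> ars; apply/eqP; rewrite -subr_eq0 -!rmorphB; apply/eqP/ker_b.
  by apply: gen_ideal_sub; exists (r - s) => //; rewrite rmorphB ars subrr.
split.
  split=> [m m' x|m x y|r m x|r m x]; rewrite ?restr_scaleE /=.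
  - rewrite !rmorphM -mulrDl -!rmorphD.
    by rewrite (bf _ (sec m + sec m')) // rmorphD !secK.
  - by rewrite mulrDr; apply: rmorphD.
  - by rewrite [LHS]rmorphM (bf _ (r * sec m)) !rmorphM ?secK ?mulrA; apply: erefl.
  - by rewrite mulrCA; apply: rmorphM.
move=> P h [hDl hDr hZl hZr].
have h0l x : h 0 x = 0.
  by apply: (addrI (h 0 x)); rewrite -hDl !addr0.
have h0r m : h m 0 = 0.
  by apply: (addrI (h m 0)); rewrite -hDr !addr0.
have hN m x : h m (- x) = - h m x.
  by apply: (addrI (h m x)); rewrite -hDr !subrr h0r.
pose m1 : restr_scalars a := (1 : M).
have rm1 r : r *: m1 = a r by rewrite restr_scaleE mulr1.
have hm m x : h m x = h m1 (f (sec m) * x) by rewrite hZr -hZl rm1 secK.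
have h_ker x : b x = 0 -> h m1 x = 0.
  move/ker_b=> Ix; rewrite -[x]mul1r; move: x Ix 1.
  apply: gen_ideal_min => [|_ [r ar0 ->] c].
    split=> [c|x y hx hy c|d x hx c]; first by rewrite mulr0 h0r.
      by rewrite mulrDr hDr hx hy addr0.
    by rewrite mulrA hx.
  by rewrite mulrC hZr -hZl rm1 ar0 h0l.
have h_eq x y : b x = b y -> h m1 x = h m1 y.
  move=> bxy; apply/eqP; rewrite -subr_eq0 -hN -hDr h_ker //.
  by rewrite rmorphB bxy subrr.
split; last first.
  move=> g g' gE g'E t; have [x bx] := b_surj t.
  suff <-: b (f (sec 1) * x) = t by rewrite gE g'E.
  rewrite rmorphM (@bf _ 1) ?secK ?rmorph1 //.
  by rewrite mul1r.
have [bsec bsecK] := surj_section b_surj.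
pose g (t : restr_scalars (b \o f)) : P := h m1 (bsec t).
have g_lin : linear g.
  move=> r t t'; rewrite /g -hZr -hDr; apply: h_eq.
  by rewrite rmorphD rmorphM !bsecK.
pose gL := GRing.isLinear.Build R _ P *:%R g g_lin.
exists (HB.pack g gL : {linear restr_scalars (b \o f) -> P}) => m x /=.
by rewrite [RHS]hm; apply: h_eq; rewrite bsecK.
Qed.

(** Multiplication by [c] embeds [R / ann c] into [R]; flatness keeps the map
    [B / (ann c) B -> B] injective. *)
Lemma flat_annihilator (R B : comPzRingType) (f : {rmorphism R -> B}) (c : R) :
  flat_morphism f ->
  forall x, f c * x = 0 -> ext_ideal f (fun r => c * r = 0) x.
Proof.
move=> f_flat x cx0; pose I r := c * r = 0.
have I_ideal : is_ideal I.
  rewrite /I; split=> [|r s r0 s0|r s s0]; first exact: mulr0.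
    by rewrite mulrDr r0 s0 addr0.
  by rewrite mulrCA s0 mulr0.
pose a : {rmorphism R -> quo_ring I} := quo_pi I.
have ker_a r : a r = 0 <-> I r.
  rewrite quo_pi_eq0; split; last exact: gen_ideal_sub.
  exact: (gen_ideal_min I_ideal).
pose J y := exists2 r, a r = 0 & y = f r.
pose b : {rmorphism B -> quo_ring J} := quo_pi J.
have [sec secK] := surj_section (@quo_pi_surj _ I : forall m, exists r, a r = m).
have [bsec bsecK] := surj_section (@quo_pi_surj _ J : forall t, exists y, b y = t).
have tens := @quotient_tensor R B (quo_ring I) (quo_ring J) f a b sec secK
  (@quo_pi_surj _ J) (@quo_pi_eq0 _ J).
have tens' : is_tensor f (fun (m : restr_scalars (idfun : {rmorphism R -> R})) y =>
    f m * y : restr_scalars (idfun \o f : {rmorphism R -> B})).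
  apply: (@quotient_tensor R B R B f idfun idfun id) => // [t|y]; first by exists t.
  split=> /= [->|]; first by have [] := gen_idealP (fun b => exists2 r, idfun r = 0 & b = f r).
  by apply: (@rmorph_gen_ideal0 _ _ idfun) => _ [r /= -> ->]; rewrite rmorph0.
have a_sec r : c * sec (a r) = c * r.
  by apply/eqP; rewrite -subr_eq0 -mulrBr; apply/eqP/ker_a; rewrite rmorphB secK subrr.
have b_sec y : f c * bsec (b y) = f c * y.
  apply/eqP; rewrite -subr_eq0 -mulrBr; apply/eqP.
  have : gen_ideal J (bsec (b y) - y) by apply/quo_pi_eq0; rewrite rmorphB bsecK subrr.
  move: (_ - _); apply: gen_ideal_min; last first.
    by move=> _ [r /ker_a cr0 ->]; rewrite -rmorphM cr0 rmorph0.
  split=> [|z t z0 t0|d z z0]; first exact: mulr0.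
    by rewrite mulrDr z0 t0 addr0.
  by rewrite mulrCA z0 mulr0.
pose u (m : restr_scalars a) : restr_scalars (idfun : {rmorphism R -> R}) :=
  c * sec m.
pose v (t : restr_scalars (b \o f)) :
    restr_scalars (idfun \o f : {rmorphism R -> B}) := f c * bsec t.
have u_lin : linear u.
  move=> r m m'; rewrite /u.
  have -> : r *: m + m' = a (r * sec m + sec m') by rewrite rmorphD rmorphM !secK.
  by rewrite a_sec mulrDr mulrCA.
have v_lin : linear v.
  move=> r t t'; rewrite /v.
  have -> : r *: t + t' = b (f r * bsec t + bsec t') by rewrite rmorphD rmorphM !bsecK.
  by rewrite b_sec mulrDr mulrCA.
pose uL := HB.pack_for {linear _ -> _} u (GRing.isLinear.Build R _ _ *:%R u u_lin).
pose vL := HB.pack_for {linear _ -> _} v (GRing.isLinear.Build R _ _ *:%R v v_lin).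
have u_inj : injective uL.
  move=> m m' /= /eqP; rewrite -subr_eq0 -mulrBr => /eqP/ker_a.
  by rewrite rmorphB !secK => /eqP; rewrite subr_eq0 => /eqP.
have v_inj : injective vL.
  apply: (f_flat _ _ _ _ _ _ _ _ tens tens' u_inj) => m y /=.
  by rewrite /v b_sec /u rmorphM mulrA.
suff /quo_pi_eq0 : quo_pi J x = 0.
  by apply: gen_ideal_min (gen_idealP _) _ _ => y [r /ker_a cr0 ->]; apply: gen_ideal_sub; exists r.
apply: v_inj; rewrite /= /v b_sec cx0.
by rewrite -[0 in RHS](rmorph0 b) b_sec mulr0.
Qed.

(** * Liftings of the spectrum of a local ring *)

(** The rational point of [Spec A] lies in some open affine [Spec B] of the
    lifting.  As [A] is local, all of [Spec A] then maps to [Spec B], and the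
    universal property of the special fibre [Spec A] shows that [B / I B] is [A],
    for [I] the kernel of [rho]. *)
Lemma liftable_affine (R A : comPzRingType) (k : fieldType)
    (rho : {rmorphism R -> k}) (iota : {rmorphism k -> A})
    (eps : {rmorphism A -> k}) :
  (forall c, exists x, rho x = c) ->
  (forall a, eps a != 0 -> exists a', a' * a = 1) ->
  liftable rho (spec_hom iota) ->
  exists (B : comPzRingType) (f : {rmorphism R -> B}) (pi : {rmorphism B -> A}),
    [/\ flat_morphism f, forall a, exists b, pi b = a,
        forall r, pi (f r) = iota (rho r) &
        forall b, pi b = 0 -> ext_ideal f (fun r => rho r = 0) b].
Proof.
move=> rho_surj A_local [X [s [i [it [[_ X_aff] s_flat _ fib_iso]]]]].
pose i1 : X A := i A (idfun : {rmorphism A -> A}).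
have iE (C : comPzRingType) (a : {rmorphism A -> C}) : i C a = zmap X a i1.
  by rewrite -zapp_nat; congr (i C _); apply: rmorph_ext.
have [B [j [u [[j_inj j_open] ju]]]] := X_aff k (i k eps).
have jE (C : comPzRingType) (b : {rmorphism B -> C}) :
    j C b = zmap X b (j B (idfun : {rmorphism B -> B})).
  by rewrite -zapp_nat; congr (j C _); apply: rmorph_ext.
have [pi j_pi] : exists pi : {rmorphism B -> A}, j A pi = i1.
  have [I [I0 ID IM] I_open] := j_open A i1.
  have [a Ia eps_a] : exists2 a, I a & eps a != 0.
    apply: contrapT => no_a; have /(I_open k eps) : exists u : spec B k, j k u = zmap X eps i1.
      by exists u; rewrite ju iE.
    have eps0 : forall a, I a -> eps a = 0.
      by move=> a Ia; apply/eqP/negPn/negP => ea; apply: no_a; exists a.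
    move=> I1; have /eqP : idfun (1 : k) = 0; last by rewrite oner_eq0.
    apply: rmorph_gen_ideal0 I1 => _ [a Ia ->]; exact: eps0.
  (* The open subscheme of [Spec A] is everything: its ideal contains a unit. *)
  have [a' a'a] := A_local a eps_a.
  have /(I_open A idfun)[pi pi_i] : gen_ideal (fun b => exists2 a, I a & b = a) 1.
    by apply: gen_ideal_sub; exists 1; rewrite // -a'a; apply: IM.
  by exists pi; rewrite pi_i zmap_id.
pose f : {rmorphism R -> B} := s B (j B (idfun : {rmorphism B -> B})).
have fE (C : comPzRingType) (b : {rmorphism B -> C}) r :
    (s C (j C b) : {rmorphism R -> C}) r = b (f r).
  by rewrite jE zapp_nat.
have pi_f r : pi (f r) = iota (rho r) by rewrite -fE j_pi it.
pose J b := exists2 r, rho r = 0 & b = f r.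
pose Q : {rmorphism B -> quo_ring J} := quo_pi J.
have [kappa kappaE] : exists kappa : {rmorphism k -> quo_ring J},
    forall r, kappa (rho r) = Q (f r).
  apply: (@rmorph_factor R k _ rho (Q \o f) rho_surj) => r r0 /=.
  by apply/quo_pi_eq0/gen_ideal_sub; exists r.
have [pibar pibarE] : exists pibar : {rmorphism quo_ring J -> A},
    forall b, pibar (Q b) = pi b.
  apply: rmorph_factor (@quo_pi_surj _ J) _ => b /quo_pi_eq0.
  by apply: rmorph_gen_ideal0 => _ [r r0 ->]; rewrite pi_f r0 rmorph0.
(* [Q] and [kappa] define a point of the special fibre, hence of [Spec A]. *)
have Q_fib : s _ (j _ Q) = spec_hom rho _ (kappa : spec k _).
  by apply: rmorph_ext => r; rewrite fE /= kappaE.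
have [sect _ sectK] := fib_iso (quo_ring J).
pose a : {rmorphism A -> quo_ring J} := sect (exist _ (j _ Q, kappa : spec k _) Q_fib).
have /(congr1 sval)/= [i_a _] := sectK (exist _ (j _ Q, kappa : spec k _) Q_fib).
rewrite -/a in i_a.
have a_pi b : a (pi b) = Q b.
  suff : (a \o pi : spec B _) = Q by move/(congr1 (fun g : {rmorphism _ -> _} => g b)).
  by apply: j_inj; rewrite -i_a iE -j_pi -zapp_nat.
(* Both sides give the same point of the lifting and the same scalars. *)
have pibar_a x : pibar (a x) = x.
  suff : (pibar \o a : spec A A) = idfun :> {rmorphism A -> A}.
    by move/(congr1 (fun g : {rmorphism _ -> _} => g x)).
  have [g gK _] := fib_iso A; apply: (can_inj gK); apply: fprod_pts_eq => /=.
  congr (_, _).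
    rewrite -[RHS]j_pi iE zmap_comp -iE i_a -zapp_nat; congr (j A _).
    by apply: rmorph_ext => b; apply: pibarE.
  apply: rmorph_ext => c /=; have [r <-] := rho_surj c.
  by rewrite -pi_f a_pi pibarE.
exists B, f, pi; split=> //.
- by apply: s_flat.
- move=> x; have [b ab] := quo_pi_surj (a x).
  by exists b; rewrite -pibarE (ab : Q b = a x) pibar_a.
- by move=> b b0; apply/quo_pi_eq0; rewrite -[LHS]/(Q b) -a_pi b0 rmorph0.
Qed.

(** * The coefficients of the obstruction *)

Section TruncatedTerms.
Variables (n e d : nat).
Local Notation N := #|trunc_mon n e d|.

Definition trunc_terms (S : comNzRingType) (c : 'I_N -> S) : seq {mpoly S[n]} :=
  [seq c j *: 'X_[trunc_mnm (enum_val j)] | j <- enum 'I_N].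

Lemma sum_trunc_terms (S : comNzRingType) (c : 'I_N -> S) :
  \sum_(y <- trunc_terms c) y = \sum_j c j *: 'X_[trunc_mnm (enum_val j)].
Proof. by rewrite big_map big_enum. Qed.

Lemma map_trunc_terms (S T : comNzRingType) (h : {rmorphism S -> T})
    (c : 'I_N -> S) (c' : 'I_N -> T) :
  (forall j, h (c j) = c' j) ->
  map (map_mpoly h) (trunc_terms c) = trunc_terms c'.
Proof.
move=> hc; rewrite /trunc_terms -map_comp; apply: eq_map => j /=.
by rewrite map_mpolyZ map_mpolyX hc.
Qed.

Lemma mdeg_trunc_mnm (m : trunc_mon n e d) : (d <= mdeg (trunc_mnm m))%N.
Proof.
rewrite mdegE; apply: leq_trans (valP m) _.
by apply: leq_sum => i _; rewrite mnmE.
Qed.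

Lemma trunc_terms_coord (k : fieldType) (f : {mpoly k[n]}) :
  ideal_pow (@m0 k n) d f ->
  gen_ideal (fun g : {mpoly k[n]} => exists i, g = 'X_i ^+ e)
    (f - \sum_(y <- trunc_terms (trunc_coord e d f ord0)) y).
Proof.
move=> f_d; set g := \sum_(y <- _) y.
have I_d : is_ideal (ideal_pow (@m0 k n) d) by case: (d) => [|d']; last exact: gen_idealP.
have g_d : ideal_pow (@m0 k n) d g.
  rewrite /g sum_trunc_terms; case: I_d => I0 ID IM; elim/big_ind: _ => // j _.
  by rewrite -mul_mpolyC; apply/IM/mpolyX_ideal_pow/mdeg_trunc_mnm.
apply/(trunc_coord_eq0 e (d := d)).
  by case: I_d => _ ID IM; apply: ID => //; rewrite -mulN1r; apply: IM.
apply/rowP => j; rewrite !mxE mcoeffB /g sum_trunc_terms raddf_sum (bigD1 j) //= big1 => [|i i_j].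
  by rewrite mcoeffZ mcoeffX eqxx mulr1 addr0 mxE subrr.
rewrite mcoeffZ mcoeffX; case: eqP => [ij|_]; last by rewrite mulr0.
case/eqP: i_j; apply/enum_val_inj/val_inj/ffunP => l; apply: val_inj.
by move/mnmP/(_ l): ij; rewrite !mnmE.
Qed.

End TruncatedTerms.

Lemma exprZ_mpolyX (S : comNzRingType) (n : nat) (c : S) (m : 'X_{1..n}) s :
  (c *: 'X_[m]) ^+ s = c ^+ s *: 'X_[m *+ s].
Proof. by rewrite exprZn mpolyXn. Qed.

Section Obstruction.
Variables (p r n d : nat).
Hypotheses (pr_p : prime p) (d_gt0 : (0 < d)%N).
Local Notation q := (p ^ r)%N.
Local Notation N := #|trunc_mon n q d|.
Local Notation defect := (@frob_defect p r _).

(** The factor [f ^ (q - 1)], for [f] the sum of the terms, turns membership of the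
    defect in [(f, x_1 ^ q, ..., x_n ^ q)] into the vanishing of coefficients,
    because [f ^ q] lies in [(x_1 ^ q, ..., x_n ^ q)] in characteristic [p]. *)
Definition defect_coef (S : comNzRingType) (c : 'I_N -> S) (e : 'X_{1..n}) : S :=
  ((\sum_(y <- trunc_terms c) y) ^+ (q - 1) * defect (trunc_terms c))@_e.

Lemma rmorph_defect_coef (S T : comNzRingType) (h : {rmorphism S -> T})
    (c : 'I_N -> S) (c' : 'I_N -> T) e :
  (forall j, h (c j) = c' j) -> h (defect_coef c e) = defect_coef c' e.
Proof.
move=> hc; rewrite /defect_coef -mcoeff_map_mpoly rmorphM rmorphXn rmorph_sum.
by rewrite rmorph_frob_defect -(map_trunc_terms hc) [X in _ = (X ^+ _ * _)@__]big_map.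
Qed.

Section Field.
Variable k : fieldType.
Hypothesis chk : p \in [pchar k].
Local Notation Kq := (gen_ideal (fun g : {mpoly k[n]} => exists i, g = 'X_i ^+ q)).

Lemma expr_sum_pchar (s : seq {mpoly k[n]}) :
  (\sum_(y <- s) y) ^+ q = \sum_(y <- s) y ^+ q.
Proof.
rewrite (frob_defectE r pr_p) -mulr_natl -mpolyC_nat (pcharf0 chk) mpolyC0.
by rewrite mul0r addr0.
Qed.

Lemma expr_mpoly_gen_pow (g : {mpoly k[n]}) : g@_0%MM = 0 -> Kq (g ^+ q).
Proof.
move=> g0; rewrite [g]mpolyE -(big_map _ xpredT id) expr_sum_pchar big_map.
apply: gen_ideal_sum => m; rewrite mcoeff_msupp => gm; rewrite exprZ_mpolyX.
have [_ _ IM] := gen_idealP (fun g : {mpoly k[n]} => exists i, g = 'X_i ^+ q).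
rewrite -mul_mpolyC; apply: IM.
have [i mi] : exists i, m i != 0%N.
  apply/existsP; apply: contraNT gm => /existsPn m0; apply/eqP; rewrite -g0.
  by congr mcoeff; apply/mnmP => i; rewrite mnm0E; apply/eqP/negPn.
by apply: (@mpolyX_gen_pow _ _ _ _ i); rewrite mulmnE leq_pmull // lt0n.
Qed.

Variable f : {mpoly k[n]}.
Hypothesis f_d : ideal_pow (@m0 k n) d f.
Local Notation v := (trunc_coord q d f ord0).
Local Notation terms := (trunc_terms v).

Lemma ideal_pow_m0_mcoeff0 (g : {mpoly k[n]}) :
  ideal_pow (@m0 k n) d g -> g@_0%MM = 0.
Proof. by move/ideal_pow_m0_mcoeff; apply; rewrite mdeg0. Qed.

Lemma frob_pi_gen_pow g : Kq g -> frob_pi p r f g = 0.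
Proof.
move=> Kg; apply/quo_pi_eq0; move: g Kg.
by apply: gen_ideal_min (gen_idealP _) _ => _ [i ->]; apply: gen_ideal_sub; left; exists i.
Qed.

Lemma frob_pi_eq : frob_pi p r f f = 0.
Proof. by apply/quo_pi_eq0/gen_ideal_sub; right. Qed.

Lemma frob_pi_trunc : \sum_(y <- terms) frob_pi p r f y = 0.
Proof.
have /frob_pi_gen_pow/eqP := trunc_terms_coord q f_d.
by rewrite rmorphB frob_pi_eq sub0r oppr_eq0 rmorph_sum => /eqP.
Qed.

Lemma defect_coef_eq0 (e : 'X_{1..n}) :
  (forall i, e i < q)%N -> frob_pi p r f (defect terms) = 0 -> defect_coef v e = 0.
Proof.
move=> e_q /quo_pi_eq0 D_0; apply: (@gen_pow_mcoeff _ _ q) e_q.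
set g := \sum_(y <- terms) y; have [K0 KD KM] := gen_idealP
  (fun g : {mpoly k[n]} => exists i, g = 'X_i ^+ q).
have fg := trunc_terms_coord q f_d; rewrite -/g in fg.
have gq : Kq (g ^+ q).
  apply: expr_mpoly_gen_pow; have := gen_pow_mcoeff fg (m := 0%MM).
  rewrite mcoeffB (ideal_pow_m0_mcoeff0 f_d) sub0r => g0.
  apply/eqP; rewrite -oppr_eq0 g0 // => i.
  by rewrite mnm0E expn_gt0 prime_gt0.
move: (frob_defect _ _ _) D_0; apply: gen_ideal_min => [|h].
  split=> [|x y Kx Ky|a x Kx]; rewrite ?mulr0 //.
    by rewrite mulrDr; apply: KD.
  by rewrite mulrCA; apply: KM.
case=> [[i ->]|->]; first by apply: KM; apply: gen_ideal_sub; exists i.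
rewrite -[f](subrK g) mulrDr; apply: KD; first exact: KM.
by rewrite -exprSr -addn1 subnK // expn_gt0 prime_gt0.
Qed.

(** The residue map takes the constant term.  The [q]-th power of an element is
    the [q]-th power of its constant term, since [x_i ^ q = 0] for every [i]. *)
Lemma frob_ring_local :
  exists eps : {rmorphism frob_ring p r f -> k},
    forall a, eps a != 0 -> exists a', a' * a = 1.
Proof.
pose c0 : {rmorphism {mpoly k[n]} -> k} := mcoeff 0%MM.
have q_gt0 : (0 < q)%N by rewrite expn_gt0 prime_gt0.
have [eps epsE] : exists eps : {rmorphism frob_ring p r f -> k},
    forall g, eps (frob_pi p r f g) = c0 g.
  apply: (@rmorph_factor {mpoly k[n]}) => [|g /quo_pi_eq0]; first exact: quo_pi_surj.
  apply: rmorph_gen_ideal0 => _ [[i ->]|->]; last exact: ideal_pow_m0_mcoeff0 f_d.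
  rewrite rmorphXn /= mcoeffX; case: eqP => [/mnmP/(_ i)|_].
    by rewrite mnm1E eqxx mnm0E.
  by rewrite expr0n -leqn0 leqNgt q_gt0.
exists eps => a; have [g <-] := quo_pi_surj a; rewrite [eps _]epsE => g0.
have : frob_pi p r f (g ^+ q) = frob_pi p r f (c0 g ^+ q)%:MP.
  have -> : g ^+ q = (g - (c0 g)%:MP) ^+ q + (c0 g ^+ q)%:MP.
    have := expr_sum_pchar [:: g - (c0 g)%:MP; (c0 g)%:MP].
    by rewrite !big_cons !big_nil !addr0 subrK => ->; rewrite (rmorphXn (@mpolyC n k)).
  rewrite rmorphD frob_pi_gen_pow ?add0r //; apply: expr_mpoly_gen_pow.
  by rewrite mcoeffB mcoeffC eqxx mulr1 subrr.
move=> gq; exists (frob_pi p r f ((c0 g ^+ q)^-1)%:MP * frob_pi p r f g ^+ (q - 1)).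
have gX : frob_pi p r f g ^+ (q - 1) * frob_pi p r f g = frob_pi p r f (c0 g ^+ q)%:MP.
  by rewrite -gq rmorphXn -exprSr -addn1 subnK.
rewrite -mulrA gX -rmorphM -mpolyCM.
by rewrite mulVf ?expf_neq0 // rmorph1.
Qed.

End Field.
End Obstruction.

(** * Nilpotent kernels and their extensions *)

(** If [rho x] had an inverse, lifted by [y], then [c = c * (1 - y * x)] while
    [1 - y * x] is nilpotent. *)
Lemma torsion_residue (R : comPzRingType) (k : fieldType)
    (rho : {rmorphism R -> k}) (c x : R) m :
  (forall c, exists x, rho x = c) -> c != 0 ->
  (forall y, rho y = 0 -> y ^+ m = 0) -> c * x = 0 -> rho x = 0.
Proof.
move=> rho_surj c0 nil cx; apply/eqP/negPn/negP => x0.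
have [y yE] := rho_surj (rho x)^-1; pose t := 1 - y * x.
have ct l : c * t ^+ l = c.
  elim: l => [|l IHl]; first by rewrite mulr1.
  by rewrite exprSr mulrA IHl /t mulrBr mulr1 mulrCA cx mulr0 subr0.
case/eqP: c0; rewrite -(ct m) nil ?mulr0 //.
by rewrite rmorphB rmorph1 rmorphM yE mulVf // subrr.
Qed.

Section ExtendedIdealPowers.
Variables (R B : comPzRingType) (f : {rmorphism R -> B}) (I : R -> Prop) (d : nat).
Hypothesis I_nil :
  forall s, (forall x, x \in s -> I x) -> (d <= size s)%N -> \prod_(x <- s) x = 0.

(** [x] behaves like an element of [(I B) ^ m] as regards products with elements
    of [I].  This is weaker than membership but is proved by a direct induction,
    without sums of products. *)
Definition ext_pow (m : nat) (x : B) : Prop :=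
  forall s, (forall y, y \in s -> I y) -> (d <= m + size s)%N ->
    x * f (\prod_(y <- s) y) = 0.

Lemma ext_pow0 x : ext_pow 0 x.
Proof. by move=> s Is s_d; rewrite I_nil // rmorph0 mulr0. Qed.

Lemma ext_powM m z x : ext_ideal f I z -> ext_pow m x -> ext_pow m.+1 (z * x).
Proof.
move=> Iz xm; move: z Iz; apply: gen_ideal_min => [|_ [r Ir ->] s Is s_d].
  split=> [s _ _|y z ym zm s Is s_d|a z zm s Is s_d]; first by rewrite !mul0r.
    by rewrite !mulrDl ym ?zm ?addr0.
  by rewrite -(mulrA a z) -(mulrA a) zm ?mulr0.
rewrite -mulrA mulrCA -rmorphM -(big_cons _ _ r s xpredT id) xm // => [y|].
  by rewrite inE => /predU1P[->|/Is].
by rewrite /= addnS.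
Qed.

Lemma ext_powX m l z x :
  ext_ideal f I z -> ext_pow m x -> ext_pow (l + m) (z ^+ l * x).
Proof.
move=> Iz xm; elim: l => [|l IHl]; first by rewrite expr0 mul1r.
by rewrite exprS -mulrA addSn; apply: ext_powM.
Qed.

Lemma ext_pow_eq0 m x : (d <= m)%N -> ext_pow m x -> x = 0.
Proof.
by move=> dm /(_ [::]); rewrite big_nil rmorph1 mulr1 addn0; apply.
Qed.

Lemma ext_ideal_expr_eq0 m z : ext_ideal f I z -> (d <= m)%N -> z ^+ m = 0.
Proof.
move=> Iz dm; apply: ext_pow_eq0 dm _.
by have := @ext_powX 0 m z 1 Iz (ext_pow0 1); rewrite mulr1 addn0.
Qed.

Lemma ext_ideal_monomial_eq0 n (z : 'I_n -> B) (m : 'X_{1..n}) :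
  (forall i, ext_ideal f I (z i)) -> (d <= mdeg m)%N -> \prod_i z i ^+ m i = 0.
Proof.
move=> Iz dm; apply: ext_pow_eq0 dm _; rewrite mdegE.
elim/big_rec2: _ => [|i x l _]; first exact: ext_pow0.
exact: ext_powX.
Qed.

End ExtendedIdealPowers.

(** * Liftings and divided powers both kill the defect *)

Section Nbhd.
Variables (p r n d : nat) (k : fieldType) (chk : p \in [pchar k]).
Hypothesis d_gt0 : (0 < d)%N.
Variable f : {mpoly k[n]}.
Hypothesis f_d : ideal_pow (@m0 k n) d f.
Local Notation q := (p ^ r)%N.
Local Notation terms := (trunc_terms (trunc_coord q d f ord0)).
Local Notation defect := (@frob_defect p r _).
Let pr_p : prime p := pcharf_prime chk.

(** Lift the terms of [f] to [B] as products of lifted coefficients and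
    variables.  Their sum and the [q]-th powers of the variables lie in [I B];
    as [I ^ d] vanishes, so do the [q]-th powers of the sum and of each term.
    Hence [p] kills their defect, which by flatness lies in [I B]. *)
Lemma defect_eq0_of_liftable (R : comPzRingType) (rho : {rmorphism R -> k}) :
  (forall c, exists x, rho x = c) ->
  (forall s, (forall x, x \in s -> rho x = 0) -> (d <= size s)%N ->
     \prod_(x <- s) x = 0) ->
  p%:R != 0 :> R -> (d <= q)%N ->
  liftable rho (frob_str p r f) -> frob_pi p r f (defect terms) = 0.
Proof.
move=> rho_surj nil p_neq0 dq; have [eps eps_loc] := frob_ring_local r pr_p d_gt0 chk f_d.
case/(liftable_affine rho_surj eps_loc) => B [h [pi [h_flat pi_surj pi_h pi_ker]]].
have [sec secK] := surj_section rho_surj.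
have [X XE] := surj_section pi_surj.
pose x i := X (frob_pi p r f 'X_i).
pose term (j : 'I_#|trunc_mon n q d|) :=
  h (sec (trunc_coord q d f ord0 j)) * \prod_i x i ^+ trunc_mnm (enum_val j) i.
pose s := [seq term j | j <- enum 'I_#|trunc_mon n q d|].
have pi_s : map pi s = map (frob_pi p r f) terms.
  rewrite -!map_comp; apply: eq_map => j /=.
  rewrite rmorphM pi_h secK -mul_mpolyC rmorphM /= mpolyXE_id.
  rewrite !rmorph_prod; congr (_ * _); apply: eq_bigr => i _.
  by rewrite !rmorphXn XE.
have x_q i : ext_ideal h (fun r => rho r = 0) (x i ^+ q).
  apply: pi_ker; rewrite rmorphXn XE -rmorphXn; apply: frob_pi_gen_pow.
  by apply: gen_ideal_sub; exists i.
have sum_s : ext_ideal h (fun r => rho r = 0) (\sum_(y <- s) y).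
  apply: pi_ker; rewrite rmorph_sum; have := frob_pi_trunc p r f_d.
  by rewrite -(big_map (frob_pi p r f) xpredT id) -pi_s big_map.
have term_q j : term j ^+ q = 0.
  rewrite exprMn -prodrXl.
  under eq_bigr do rewrite -exprM mulnC exprM.
  by rewrite (ext_ideal_monomial_eq0 nil x_q) ?mulr0 // mdeg_trunc_mnm.
have p_defect : h p%:R * defect s = 0.
  have := frob_defectE r pr_p s.
  rewrite (ext_ideal_expr_eq0 nil sum_s dq) big_map big1 // add0r.
  by rewrite rmorph_nat mulr_natl => <-.
rewrite rmorph_frob_defect -pi_s -rmorph_frob_defect.
apply: (@rmorph_gen_ideal0 _ _ pi _ _ _ (flat_annihilator h_flat p_defect)).
have pow_d y : rho y = 0 -> y ^+ d = 0.
  move=> y0; have := nil (nseq d y); rewrite big_nseq iter_mulr_1 size_nseq; apply=> //.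
  by move=> z; rewrite mem_nseq => /andP[_ /eqP->].
move=> _ [c /(torsion_residue rho_surj p_neq0 pow_d) c0 ->].
by rewrite pi_h c0 rmorph0.
Qed.

End Nbhd.

(** In [g p (y + t)] the inner terms [g i y * g (p - i) t] are, up to factorials,
    the monomials of the carry, since [i! * g i y = y ^ i]; the factor [(p - 1)!]
    makes the coefficients equal without dividing by factorials. *)
Lemma frob_defect_pd (A : comPzRingType) (I : A -> Prop) (g : nat -> A -> A) p s :
  prime p -> is_ideal I -> pd_structure I g ->
  (forall y, y \in s -> I y /\ g p y = 0) ->
  I (\sum_(y <- s) y) /\
  frob_defect p 1 s = (p.-1)`!%:R * g p (\sum_(y <- s) y).
Proof.
move=> pr_p [I0 ID IM] pd; have gn m x : I x -> x ^+ m = m`!%:R * g m x.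
  move=> Ix; elim: m => [|m IHm]; first by rewrite (pd0 pd) // mulr1.
  rewrite exprS IHm mulrCA -{1}(pd1 pd Ix) (pdM pd) // mulrA -natrM.
  by rewrite add1n bin1 factS mulnC.
have p_gt0 := prime_gt0 pr_p.
have g0 : g p 0 = 0 by rewrite -[in LHS](mul0r 0) (pdZ pd) // expr0n gtn_eqF // mul0r.
elim: s => [|y s IHs] Is; first by rewrite big_nil g0 mulr0.
have [|Isum IHE] := IHs; first by move=> z sz; apply: Is; rewrite inE sz orbT.
have [Iy gy] := Is y (mem_head _ _).
rewrite /= big_cons; split; first exact: ID.
set t := \sum_(z <- s) z in Isum IHE *.
rewrite IHE (pdD pd) // -(big_mkord xpredT (fun i => g i y * g (p - i)%N t)).
rewrite big_nat_recr // big_ltn //= subn0 subnn (pd0 pd) // (pd0 pd) // gy.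
rewrite mul1r mul0r addr0 mulrDr; congr (_ + _).
rewrite /frob_carry expn1 mulr_sumr !big_nat; apply: eq_bigr => i /andP[i_gt0 lt_ip].
have fact_bin : (p.-1`! = (p - i)`! * i`! * ('C(p, i) %/ p))%N.
  apply/eqP; rewrite -(eqn_pmul2l p_gt0) -{1}(prednK p_gt0) -factS prednK //.
  rewrite mulnC -mulnA divnK ?prime_dvd_bin ?i_gt0 //.
  by rewrite -(bin_fact (ltnW lt_ip)) mulnC [(i`! * _)%N]mulnC.
rewrite (gn _ _ Isum) (gn _ _ Iy) -mulr_natr fact_bin !natrM.
by rewrite mulrACA [LHS]mulrAC [g _ t * _]mulrC.
Qed.

(** Each term of [f] has degree at least two, so it is a product of some [x_i]
    with an element whose [p]-th power vanishes: its [p]-th divided power is zero. *)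
Lemma defect_eq0_of_pd (p n d : nat) (k : fieldType) (chk : p \in [pchar k])
    (f : {mpoly k[n]}) g :
  (1 < d)%N -> ideal_pow (@m0 k n) d f -> pd_structure (@m0_frob k n p 1 f) g ->
  frob_pi p 1 f (frob_defect p 1 (trunc_terms (trunc_coord (p ^ 1) d f ord0))) = 0.
Proof.
move=> d_gt1 f_d pd; set s := trunc_terms _; have pr_p := pcharf_prime chk.
have [I0 ID IM] := gen_idealP (fun a => exists2 g, m0 g & a = frob_pi p 1 f g).
have g_sum0 : g p 0 = 0.
  by rewrite -[in LHS](mul0r 0) (pdZ pd) // expr0n gtn_eqF ?mul0r // prime_gt0.
have [||_] := @frob_defect_pd _ _ g p (map (frob_pi p 1 f) s) pr_p _ pd.
- exact: gen_idealP.
- move=> _ /mapP[_ /mapP[j _ ->] ->]; set m := trunc_mnm _; set c := _ ord0 j.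
  have m_gt1 : (1 < mdeg m)%N := leq_trans d_gt1 (mdeg_trunc_mnm _).
  have [i mi] : exists i, (0 < m i)%N.
    apply/existsP; apply: contraLR m_gt1 => /existsPn m0.
    by rewrite -leqNgt mdegE big1 // => i _; apply/eqP; rewrite -leqn0 leqNgt m0.
  have def_m : m = (m - U_(i) + U_(i))%MM.
    by rewrite submK //; apply/mnm_lepP => l; rewrite mnm1E; case: eqP => // <-.
  have xi : m0_frob (frob_pi p 1 f 'X_i).
    by apply: gen_ideal_sub; exists 'X_i => //; apply: gen_ideal_sub; exists i.
  rewrite def_m mpolyXD scalerAl rmorphM; split; first exact: IM.
  rewrite (pdZ pd) // -rmorphXn frob_pi_gen_pow ?mul0r //.
  apply: (@expr_mpoly_gen_pow p 1) => //.
  rewrite mcoeffZ mcoeffX; case: eqP => [m'0|_]; last exact: mulr0.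
  by move: m_gt1; rewrite def_m m'0 mdegD mdeg0 mdeg1.
- rewrite rmorph_frob_defect => ->.
  by rewrite big_map (frob_pi_trunc p 1 f_d) g_sum0 mulr0.
Qed.

(** * A form with non-zero obstruction *)

Lemma mcoeffMX_eq0 (S : comNzRingType) n (g : {mpoly S[n]}) (m e : 'X_{1..n}) i :
  (e i < m i)%N -> (g * 'X_[m])@_e = 0.
Proof.
move=> ei; rewrite mcoeffM big1 // => -[[a ?] [b ?]] /= /eqP e_ab.
rewrite mcoeffX; case: eqP => [mb|_]; last exact: mulr0.
by move: ei; rewrite e_ab mnmDE -mb ltnNge leq_addl.
Qed.

Section Witness.
Variables (p r n d : nat).
Hypotheses (pr_p : prime p) (r_gt0 : (0 < r)%N) (d_gt0 : (0 < d)%N).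
Hypothesis le_3d_n : (3 * d <= n)%N.
Local Notation q := (p ^ r)%N.
Local Notation c := (p ^ r.-1)%N.
Local Notation N := #|trunc_mon n q d|.

Let in_block (t i : nat) : bool := (i %/ d == t)%N.

(** The exponent of the product of the [d] variables [x_i] with
    [t * d <= i < t * d + d], indices starting at zero. *)
Definition block_mnm t : 'X_{1..n} := [multinom (in_block t i : nat) | i < n].

Lemma bool_lt_expn (b : bool) : (b < q)%N.
Proof.
have : (1 < q)%N by rewrite -(expn0 p) ltn_exp2l ?prime_gt1.
by apply: leq_trans; case: b.
Qed.

Definition block_ffun t : {ffun 'I_n -> 'I_q} :=
  [ffun i : 'I_n => Ordinal (bool_lt_expn (in_block t i))].

Lemma block_degree (t : 'I_3) : (d <= \sum_i block_ffun t i)%N.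
Proof.
have td_n : (t * d + d <= n)%N.
  by rewrite -mulSnr (leq_trans _ le_3d_n) // leq_pmul2r.
rewrite (eq_bigr (fun i : 'I_n => in_block t i : nat)); last by move=> i _; rewrite ffunE.
rewrite -(big_mkord xpredT (fun i => in_block t i : nat)).
rewrite (big_cat_nat (leq0n _) td_n) (big_cat_nat (leq0n (t * d)) (leq_addr _ _)) /=.
rewrite addnAC; apply: leq_trans (leq_addl _ _).
rewrite big_nat (eq_bigr (fun=> 1%N)); last first.
  move=> i /andP[ti it].
  by rewrite /in_block eqn_leq leq_divRL // ti -ltnS ltn_divLR // mulSnr it.
by rewrite -big_nat sum_nat_const_nat muln1 addKn.
Qed.

Definition block (t : 'I_3) : 'I_N :=
  enum_rank (Sub (block_ffun t) (block_degree t) : trunc_mon n q d).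

Lemma trunc_mnm_block t : trunc_mnm (enum_val (block t)) = block_mnm t.
Proof. by apply/mnmP => i; rewrite enum_rankK !mnmE /= ffunE. Qed.

Definition block_coord (S : comNzRingType) (j : 'I_N) : S :=
  (\sum_t (j == block t))%:R.

Lemma sum_block_terms (S : comNzRingType) :
  \sum_(y <- trunc_terms (block_coord S)) y =
    'X_[block_mnm 0] + ('X_[block_mnm 1] + 'X_[block_mnm 2]).
Proof.
rewrite sum_trunc_terms; under eq_bigr do rewrite /block_coord natr_sum scaler_suml.
rewrite exchange_big; transitivity (\sum_(t < 3) 'X_[block_mnm t] : {mpoly S[n]}).
  apply: eq_bigr => t _; rewrite (bigD1 (block t)) //= eqxx scale1r trunc_mnm_block.
  by rewrite big1 ?addr0 // => j /negPf->; rewrite scale0r.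
by rewrite !big_ord_recl big_ord0 addr0.
Qed.

(** In [(u + v + w) ^ (2 q - 1)] all multinomial coefficients at exponents below
    [q] are divisible by [p]; at [(q - 1, q - q / p, q / p)] the coefficient is not
    divisible by [p ^ 2]. *)
Definition block_exponent : 'X_{1..n} :=
  (block_mnm 0 *+ (q - 1) + (block_mnm 1 *+ (q - c) + block_mnm 2 *+ c))%MM.

Lemma block_mnmE (s t : nat) (i : 'I_n) :
  i = (t * d)%N :> nat -> block_mnm s i = (s == t).
Proof. by move=> it; rewrite mnmE /in_block it mulnK // eq_sym. Qed.

Lemma block_mnm_eq a b l :
  ((block_mnm 0 *+ a + (block_mnm 1 *+ b + block_mnm 2 *+ l))%MM == block_exponent)
    = [&& a == q - 1, b == q - c & l == c]%N.
Proof.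
apply/eqP/and3P => [|[/eqP-> /eqP-> /eqP->] //]; rewrite /block_exponent => /mnmP E.
have Et t : (t < 3)%N -> exists i : 'I_n, i = (t * d)%N :> nat.
  move=> lt_t3; have lt_n : (t * d < n)%N.
    by rewrite (leq_trans _ le_3d_n) // ltn_pmul2r.
  by exists (Ordinal lt_n).
have [i0 E0] := Et 0%N isT; have [i1 E1] := Et 1%N isT; have [i2 E2] := Et 2%N isT.
have := E i0; have := E i1; have := E i2; rewrite !mnmDE !mulmnE.
rewrite !(block_mnmE _ E0) !(block_mnmE _ E1) !(block_mnmE _ E2) /=.
by rewrite !mul0n !mul1n !addn0 !add0n => -> -> ->.
Qed.

Lemma block_exponent_lt i : (block_exponent i < q)%N.
Proof.
have p_gt1 := prime_gt1 pr_p.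
have c_gt0 : (0 < c)%N by rewrite expn_gt0 prime_gt0.
have c_lt : (c < q)%N by rewrite ltn_exp2l // prednK.
have q_gt0 : (0 < q)%N := ltn_trans c_gt0 c_lt.
rewrite !mnmDE !mulmnE !mnmE /in_block.
case: (i %/ d)%N => [|[|[|t]]] //=; rewrite ?mul0n ?mul1n ?addn0 ?add0n //.
  by rewrite subn1 prednK.
by rewrite ltn_subrL c_gt0.
Qed.

Lemma mcoeff_block_power :
  (('X_[block_mnm 0] + ('X_[block_mnm 1] + 'X_[block_mnm 2])) ^+ (2 * q - 1))@_block_exponent
    = ('C(2 * q - 1, q) * 'C(q, c))%:R :> int.
Proof.
have q_gt0 : (0 < q)%N by rewrite expn_gt0 prime_gt0.
have c_le : (c <= q)%N by rewrite leq_exp2l ?prime_gt1 // leq_pred.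
have q_lt : (q < (2 * q - 1).+1)%N by rewrite subn1 prednK ?muln_gt0 // mul2n -addnn -addn1 leq_add2l.
rewrite exprDn raddf_sum (bigD1 (Ordinal q_lt)) //= big1 => [|i /negPf i_q].
  rewrite addr0 mcoeffMn exprDn mulr_sumr raddf_sum.
  rewrite (bigD1 (inord c : 'I_q.+1)) //= inordK // big1 => [|l /negPf l_c].
    rewrite addr0 mulrnAr mcoeffMn !mpolyXn -!mpolyXD mcoeffX block_mnm_eq /=.
    have -> : (2 * q - 1 - q = q - 1)%N by rewrite subnAC mul2n -addnn addnK.
    rewrite eqxx.
    by rewrite !eqxx -mulrnA mulnC.
  rewrite mulrnAr mcoeffMn !mpolyXn -!mpolyXD mcoeffX block_mnm_eq.
  by rewrite (_ : (l == c :> nat) = false) ?andbF ?mul0rn // -l_c -val_eqE /= inordK.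
rewrite mcoeffMn exprDn mulr_sumr raddf_sum big1 ?mul0rn //= => l _.
rewrite mulrnAr mcoeffMn !mpolyXn -!mpolyXD mcoeffX block_mnm_eq.
case: and3P => [[/eqP iq _ _]|]; last by rewrite mul0rn.
have i_le : (i <= 2 * q - 1)%N by rewrite -ltnS.
case/negP: i_q; rewrite -val_eqE /= -(subKn i_le) iq.
by rewrite mul2n -addnn -addnBA // addnK.
Qed.

Lemma defect_coef_block (k : fieldType) :
  p \in [pchar k] -> defect_coef (block_coord k) block_exponent != 0.
Proof.
move=> chk; pose G := defect_coef (block_coord int) block_exponent.
have q_gt0 : (0 < q)%N by rewrite expn_gt0 prime_gt0.
have -> : defect_coef (block_coord k) block_exponent = G%:~R.
  by apply/esym/rmorph_defect_coef => j; rewrite rmorph_nat.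
have GE : G *+ p = ('C(2 * q - 1, q) * 'C(q, c))%:R.
  rewrite -mcoeff_block_power -(sum_block_terms int).
  have -> : (2 * q - 1 = (q - 1) + q)%N by rewrite mul2n -addnn addnBAC.
  rewrite exprD (frob_defectE r pr_p) mulrDr mcoeffD mulrnAr mcoeffMn -/G.
  rewrite mulr_sumr raddf_sum big_map big1 ?add0r // => j _ /=.
  rewrite exprZ_mpolyX -scalerAr mcoeffZ.
  have [i mi] : exists i, trunc_mnm (enum_val j) i != 0%N.
    apply/existsP; apply: contraLR (mdeg_trunc_mnm (enum_val j)) => /existsPn m0.
    by rewrite -ltnNge mdegE big1 // => i _; apply/eqP/negPn.
  rewrite (@mcoeffMX_eq0 _ _ _ _ _ i) ?mulr0 // mulmnE.
  by apply: leq_trans (block_exponent_lt i) _; rewrite leq_pmull // lt0n.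
(* The factor [p] of the second binomial coefficient cancels. *)
have {GE} -> : G = ('C(2 * q - 1, q) * 'C(q.-1, c.-1))%:R.
  apply/eqP; rewrite -subr_eq0.
  have /eqP : (G - ('C(2 * q - 1, q) * 'C(q.-1, c.-1))%:R) *+ p = 0.
    by rewrite mulrnBl GE bin_expn_expn_pred // -mulrnA mulnCA mulnC subrr.
  by rewrite Num.Theory.mulrn_eq0 (gtn_eqF (prime_gt0 pr_p)).
rewrite rmorph_nat -(dvdn_pcharf chk) Euclid_dvdM // negb_or ndvdn_bin_double //=.
apply: ndvdn_bin_expn_pred => //; rewrite prednK ?expn_gt0 ?prime_gt0 //.
by rewrite leq_exp2l ?prime_gt1 // leq_pred.
Qed.

End Witness.

(** * Generic non-vanishing *)

Lemma generic_defect_neq0 (p r n d : nat) (k : fieldType) :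
  p \in [pchar k] -> (0 < r)%N -> (0 < d)%N -> (3 * d <= n)%N ->
  exists U : 'rV[k]_#|trunc_mon n (p ^ r) d| -> Prop,
    [/\ zariski_open U, exists v, U v &
      forall f : {mpoly k[n]}, ideal_pow (@m0 k n) d f ->
        U (trunc_coord (p ^ r) d f) ->
        frob_pi p r f (frob_defect p r
          (trunc_terms (trunc_coord (p ^ r) d f ord0))) <> 0].
Proof.
move=> chk r_gt0 d_gt0 le_3d_n; have pr_p := pcharf_prime chk.
pose e := block_exponent p r n d.
exists (fun v => defect_coef (v ord0) e != 0); split.
(* With indeterminates as coefficients, [defect_coef] is the open condition. *)
- pose G := defect_coef (fun j => 'X_j : {mpoly k[#|trunc_mon n (p ^ r) d|]}) e.
  exists (fun P => P = G) => v.
  have GE : G.@[v ord0] = defect_coef (v ord0) e.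
    by apply: rmorph_defect_coef => j; apply: mevalXU.
  by split=> [ve|[_ ->]]; [exists G; rewrite ?GE | rewrite GE].
- exists (\row_j block_coord pr_p r_gt0 d_gt0 le_3d_n k j).
  have := defect_coef_block pr_p r_gt0 d_gt0 le_3d_n chk.
  rewrite -/e; congr (_ != _); congr defect_coef.
  by apply/funext => j; rewrite mxE.
move=> f f_d /eqP ve De; apply: ve.
by apply: defect_coef_eq0 De => // i; apply: block_exponent_lt.
Qed.

(** * The coefficient rings *)

(** Adding up ones gives [m = (m, - carries m)], where [p * carries m = m ^ p - m]
    over the integers.  So the second component of [p] is [1 - p ^ (p - 1)], which is
    [1] in [k]. *)
Lemma witt2_natr_neq0 (p : nat) (pr_p : prime p) (k : fieldType) :
  p \in [pchar k] -> p%:R != 0 :> witt2 pr_p k.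
Proof.
move=> chk; have p_gt0 := prime_gt0 pr_p.
pose carries m : int := \sum_(j < m) witt_carry p j%:R 1.
have carriesE m : carries m *+ p = m%:R ^+ p - m%:R.
  rewrite /carries; elim: m => [|m IHm].
    by rewrite big_ord0 mul0rn expr0n gtn_eqF // subr0.
  rewrite big_ord_recr mulrnDl IHm /= (witt_carryE pr_p) expr1n -natr1.
  by rewrite addrC [_ - 1]addrAC addrA subrK opprD addrA addrAC.
have natE m : m%:R = Witt2 pr_p m%:R (- (carries m)%:~R : k).
  elim: m => [|m IHm]; first by rewrite /carries big_ord0 oppr0.
  rewrite -natr1 IHm -[LHS]/(witt2_add _ _) /witt2_add /=.
  congr Witt2; first by rewrite -natr1.
  rewrite /carries big_ord_recr /= rmorphD opprD addr0; congr (_ - _).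
  by rewrite rmorph_witt_carry rmorph_nat rmorph1.
have carries_p : carries p = p%:R ^+ p.-1 - 1.
  apply/eqP; rewrite -subr_eq0.
  have /eqP : (carries p - (p%:R ^+ p.-1 - 1)) *+ p = 0.
    rewrite mulrnBl carriesE -[X in _ - X]mulr_natr mulrBl mul1r -exprSr.
    by rewrite prednK // subrr.
  by rewrite Num.Theory.mulrn_eq0 (gtn_eqF p_gt0).
apply/eqP; rewrite natE carries_p => /(congr1 (@witt1 _ _ _)) /= /eqP.
rewrite rmorphB rmorphXn rmorph_nat (pcharf0 chk) expr0n rmorph1.
by rewrite gtn_eqF ?sub0r ?opprK ?oner_eq0 // -ltnS prednK // prime_gt1.
Qed.

Lemma witt2_res_kernel_sqr (p : nat) (pr_p : prime p) (k : fieldType)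
    (x y : witt2 pr_p k) :
  p \in [pchar k] -> witt2_res x = 0 -> witt2_res y = 0 -> x * y = 0.
Proof.
case: x y => [x0 x1] [y0 y1] chk; rewrite /witt2_res /= => -> ->.
rewrite -[LHS]/(witt2_mul _ _) /witt2_mul /= expr0n gtn_eqF ?prime_gt0 //.
by rewrite !mul0r mulr0 !add0r -mulr_natl (pcharf0 chk) mul0r.
Qed.

Lemma ideal_pow_prod (R : comPzRingType) (I : R -> Prop) m (s : seq R) :
  (forall x, x \in s -> I x) -> (m <= size s)%N ->
  ideal_pow I m (\prod_(x <- s) x).
Proof.
elim: m s => [//|m IHm] [//|x s] Is /= ms; rewrite big_cons.
apply: gen_ideal_sub; exists x, (\prod_(y <- s) y); split=> //.
  by apply: Is; rewrite mem_head.
by apply: IHm => // y sy; apply: Is; rewrite inE sy orbT.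
Qed.

Lemma local_residue_kernel (R : comPzRingType) (k : fieldType)
    (rho : {rmorphism R -> k}) (mR : R -> Prop) :
  local_ring_at mR -> (forall c, exists x, rho x = c) ->
  forall x, rho x = 0 <-> mR x.
Proof.
move=> [_ mR_uniq] rho_surj; apply: mR_uniq; split.
- split=> [|x y x0 y0|a x x0]; first exact: rmorph0.
    by rewrite rmorphD x0 y0 addr0.
  by rewrite rmorphM x0 mulr0.
- by move=> /eqP; rewrite rmorph1 oner_eq0.
move=> J [J0 JD JM] J1 kerJ x Jx; apply/eqP/negPn/negP => x0; apply: J1.
have [y yE] := rho_surj (rho x)^-1.
rewrite -[1](subrK (y * x)); apply: JD; last exact: JM.
by apply: kerJ; rewrite rmorphB rmorph1 rmorphM yE mulVf // subrr.
Qed.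

Theorem theorem0p2 (k : closedFieldType) (p : nat) (chk : p \in [pchar k]) :
  (forall n : nat, (6 <= n)%N ->
     exists U : 'rV[k]_#|trunc_mon n p 2| -> Prop,
       [/\ zariski_open U, exists v, U v &
        forall f : {mpoly k[n]}, ideal_pow (@m0 k n) 2 f ->
          U (trunc_coord p 2 f) ->
          ~ (exists g, pd_structure (@m0_frob k n p 1 f) g) /\
          ~ liftable (@witt2_res p (pcharf_prime chk) k) (frob_str p 1 f)])
  /\
  (forall r n : nat, (1 <= r)%N -> (3 * p ^ r <= n)%N ->
     exists U : 'rV[k]_#|trunc_mon n (p ^ r) (p ^ r)| -> Prop,
       [/\ zariski_open U, exists v, U v &
        forall f : {mpoly k[n]}, ideal_pow (@m0 k n) (p ^ r) f ->
          U (trunc_coord (p ^ r) (p ^ r) f) ->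
          forall (R : comPzRingType) (mR : R -> Prop) (rho : {rmorphism R -> k}),
            local_ring_at mR -> (forall c : k, exists x, rho x = c) ->
            p%:R != 0 :> R -> (forall x, ideal_pow mR (p ^ r) x -> x = 0) ->
            ~ liftable rho (frob_str p r f)]).

Proof.
have pr_p := pcharf_prime chk; split=> [n n_ge6|r n r_gt0 n_ge].
  have [U [U_open U_ex U_neq0]] := generic_defect_neq0 chk (isT : 0 < 1)%N (isT : 0 < 2)%N n_ge6.
  exists U; split=> // f f_2 Uf; split=> [[g pd]|lif]; apply: (U_neq0 f f_2 Uf).
    exact: (defect_eq0_of_pd chk _ f_2 pd).
  apply: (defect_eq0_of_liftable chk _ f_2 _ _ _ _ lif) => //.
  - by move=> c; exists (Witt2 _ c 0).
  - move=> [|x [|y s]] // xys _; rewrite !big_cons mulrA.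
    have x0 := xys x (mem_head _ _).
    have y0 : witt2_res y = 0 by apply: xys; apply: mem_behead; apply: mem_head.
    by rewrite (witt2_res_kernel_sqr chk x0 y0) mul0r.
  - exact: witt2_natr_neq0.
  - exact: prime_gt1.
have q_gt0 : (0 < p ^ r)%N by rewrite expn_gt0 prime_gt0.
have [U [U_open U_ex U_neq0]] := generic_defect_neq0 chk r_gt0 q_gt0 n_ge.
exists U; split=> // f f_q Uf R mR rho R_loc rho_surj p_neq0 mR_nil lif.
apply: (U_neq0 f f_q Uf); have ker_rho := local_residue_kernel R_loc rho_surj.
have nil s : (forall x, x \in s -> rho x = 0) -> (p ^ r <= size s)%N ->
    \prod_(x <- s) x = 0.
  by move=> s0 s_q; apply/mR_nil/ideal_pow_prod => // x /s0/ker_rho.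
exact: (defect_eq0_of_liftable chk q_gt0 f_q rho_surj nil p_neq0 _ lif).
Qed.
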